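(* Let $0 \le d \le n$ be integers and let $P \subset \mathbb{R}^n$ be a convex lattice polytope with $\dim P = d$. Then for every integer $t > 0$, \[ \mathcal H(P^\circ;t) = \mathcal E((\mathrm{Pyr}\,P)^\circ;t+1) = (-1)^{d+1}\,\mathcal H(P;-t-1), \] where $\mathcal H(P;-t-1)$ denotes the value at $-t-1$ of the polynomial $\mathcal H(P;\cdot)$.
   Context: A convex lattice polytope in $\mathbb{R}^n$ is the convex hull of a nonempty finite subset of $\mathbb{Z}^n$. $S^\circ$ denotes the relative interior of a polytope $S$. For a bounded convex set $S \subset \mathbb{R}^m$ and an integer $t \ge 0$, $\mathcal E(S;t) := \#(tS \cap \mathbb{Z}^m)$. $\mathrm{Pyr}\,P \subset \mathbb{R}^{n+1}$ is the convex hull of $\{(v,0) : v \in V\} \cup \{(0,\dots,0,1)\}$, where $V \subset \mathbb{Z}^n$ is the vertex set of $P$. A horizontal giganture of $P$ is a polytope $G \subset \mathbb{R}^n$ such that $G = iP + a$ for some integer $i \ge 0$ and some $a \in \mathbb{Z}^n$ (for $i=0$ it is a single point). For an integer $t \ge 0$, $\mathcal H(P;t)$ is the number of horizontal gigantures of $P$ contained in $tP$. For an integer $t > 0$, $\mathcal H(P^\circ;t)$ is the number of horizontal gigantures of $P$ contained in $tP^\circ$. It is known that $\mathcal H(P;t)$ is a polynomial in $t$; this polynomial is used to define $\mathcal H(P;-t-1)$.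
   Formalization: The formal theorem assumes d ≥ 1; for d = 0 the claim is false: if P = {v}, the only giganture in tP or tP° is {tv}, so H(P°;t) = 1 and H(P;·) = 1, while E((Pyr P)°;t+1) = t and (-1)^{1}H(P;-t-1) = -1. *)

(* Defs.v *)
From HB Require Import structures.
From mathcomp Require Import all_boot all_order all_algebra finmap.
From mathcomp Require Import all_classical all_reals all_analysis.

Set Implicit Arguments.
Unset Strict Implicit.
Unset Printing Implicit Defensive.

Import Order.TTheory GRing.Theory Num.Theory numFieldNormedType.Exports.
Local Open Scope classical_set_scope.
Local Open Scope ring_scope.

(* [fset_set] is empty on infinite sets, so infinite sets get cardinal 0; all
   sets counted below are finite when the ambient sets are bounded. *)
Definition ncard (T : choiceType) (A : set T) : nat := #|` fset_set A|%fset.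

Section Polytopes.
Variables (R : realType) (m : nat).
Implicit Types (S : set 'rV[R]_m) (d t : nat).

Definition lattice_point (a : 'rV[int]_m) : 'rV[R]_m := map_mx intr a.

Definition convex_hull S : set 'rV[R]_m :=
  smallest (fun C => @convex_set R 'rV[R]_m C) S.

Definition affine_set S : Prop :=
  forall (l : R) x y, S x -> S y -> S (l *: x + (1 - l) *: y).

Definition affine_hull S : set 'rV[R]_m := smallest affine_set S.

(* The affine hull of S is a translate of the row space of a rank-d matrix. *)
Definition has_dim S d : Prop :=
  exists x0 : 'rV[R]_m, exists2 B : 'M[R]_(d, m),
    row_free B & affine_hull S = [set x0 + u *m B | u in [set: 'rV[R]_d]].

Definition relint S : set 'rV[R]_m :=
  [set x | S x /\ within (affine_hull S) (nbhs x) S].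

Definition lattice_polytope S : Prop :=
  exists2 A : set 'rV[int]_m,
    finite_set A /\ A !=set0 & S = convex_hull (lattice_point @` A).

Definition vertices S : set 'rV[R]_m :=
  [set v | S v /\ ~ convex_hull (S `\ v) v].

Definition dilate t S : set 'rV[R]_m := [set t%:R *: x | x in S].

Definition ehrhart S t : nat :=
  ncard [set a : 'rV[int]_m | dilate t S (lattice_point a)].

Definition giganture S (G : set 'rV[R]_m) : Prop :=
  exists (i : nat) (a : 'rV[int]_m),
    G = [set i%:R *: x + lattice_point a | x in S].

Definition giganture_count S (X : set 'rV[R]_m) : nat :=
  ncard [set G : set 'rV[R]_m | giganture S G /\ G `<=` X].

(* H(S;t) and H(S°;t); in both cases the gigantures are those of S itself. *)
Definition Hcount S t : nat := giganture_count S (dilate t S).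
Definition Hcount_int S t : nat := giganture_count S (dilate t (relint S)).

(* The polynomial interpolating H(S;t) at all t >= 0. It is unique, and exists
   for lattice polytopes; the default 0 is returned if there is none. *)
Definition Hpoly S : {poly R} :=
  xget 0 [set q : {poly R} | forall t : nat, q.[t%:R] = (Hcount S t)%:R].

End Polytopes.

Definition pyramid (R : realType) (n : nat) (P : set 'rV[R]_n) :
    set 'rV[R]_(n + 1) :=
  convex_hull ([set row_mx v (0 : 'rV[R]_1) | v in vertices P]
               `|` [set row_mx (0 : 'rV[R]_n) (1 : 'rV[R]_1)]).

(* Main.v *)
(* Write P as the convex hull of the rows v_i of an integer matrix and let C be
   the cone over the vectors w_i = (v_i, 1). If iP + a is contained in tP, then
   each vertex relation i v_l + a = sum_m c_lm v_m has nonnegative coefficients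
   of sum t; averaging these relations with a stationary vector of the matrix
   (c_lm) gives a = (t - i) p with p in P. Hence H(P; t) counts the lattice
   points of C of height at most t, and H(P°; t), like E((Pyr P)°; t + 1),
   those of the interior of C.

   A generic linear cost on the w_i singles out the optimal bases, which
   triangulate C by linear programming duality. Moving points by an
   infinitesimal multiple of a generic interior vector g (resp. of -g) turns
   the triangulation into a partition of C (resp. of its interior) into
   half-open simplicial cones, with opposite faces removed in the two cases. A
   lattice point of such a cone is uniquely a lattice point b of the half-open
   unit box plus a nonnegative integer combination of the d + 1 generators, so
   each b accounts for binom(t + d + 1 - height b, d + 1) points of height at
   most t; reflecting the box exchanges the two kinds of cones and realizes
   t |-> -t - 1. *)

Require Import Defs.
From mathcomp Require Import all_boot all_order all_algebra finmap.
From mathcomp Require Import all_classical all_reals all_analysis.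
From mathcomp Require Import ring lra zify.
Import Order.TTheory GRing.Theory Num.Theory numFieldNormedType.Exports.
Local Open Scope classical_set_scope.
Local Open Scope ring_scope.

Set Implicit Arguments.
Unset Strict Implicit.
Unset Printing Implicit Defensive.

(** * Regular triangulations of cones *)

(** The product of the [p x] is a nonzero polynomial and cannot vanish at all positive integers. *)
Lemma generic_positive (R : realFieldType) (T : finType) (S : pred T)
    (p : T -> {poly R}) :
  (forall x, S x -> p x != 0) ->
  exists2 tau : R, 0 < tau & forall x, S x -> (p x).[tau] != 0.
Proof.
move=> p_neq0; pose q := \prod_(x | S x) p x.
have q_neq0 : q != 0 by apply/prodf_neq0.
suff [i /negPf qi] : exists i : nat, ~~ root q i.+1%:R.
  exists i.+1%:R => [|x Sx]; first by rewrite ltr0Sn.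
  apply/negP => px0; move: qi; rewrite /root /q horner_prod.
  by rewrite (bigD1 x) //= (eqP px0) mul0r eqxx.
apply: contrapT => /forallNP no.
pose s : seq R := [seq i.+1%:R | i <- iota 0 (size q)].
have /(max_poly_roots q_neq0) : all (root q) s.
  by apply/allP => _ /mapP[i _ ->]; move/negP: (no i); rewrite negbK.
rewrite map_inj_uniq ?iota_uniq; last first.
  by move=> i j /eqP; rewrite eqr_nat => /eqP[].
by move=> /(_ isT); rewrite size_map size_iota ltnn.
Qed.

Lemma small_perturbation (R : realFieldType) (T : finType) (a b : T -> R) :
  (forall x, 0 < a x) ->
  exists2 e : R, 0 < e & forall x s, 0 < s <= e -> 0 < a x - s * `|b x|.
Proof.
(* [M] exceeds every ratio [|b x| / a x], so a step of at most [1 / M] is safe for all [x] at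
   once. *)
move=> a_gt0; pose M := 1 + \sum_x `|b x| / a x.
have sum_ge0 (S : pred T) : 0 <= \sum_(x | S x) `|b x| / a x.
  by apply: sumr_ge0 => x _; rewrite divr_ge0 // ltW.
have M_gt0 : 0 < M by rewrite ltr_pwDl // sum_ge0.
exists M^-1 => [|x s /andP[s_gt0 les]]; first by rewrite invr_gt0.
rewrite subr_gt0; apply: (@le_lt_trans _ _ (M^-1 * `|b x|)).
  by rewrite ler_wpM2r.
rewrite mulrC ltr_pdivrMr // mulrC -ltr_pdivrMr //.
rewrite /M (bigD1 x) //= addrCA ltrDl ltr_pwDl //; exact: sum_ge0.
Qed.

Section Cones.
Variables (R : realType) (k m : nat) (W : 'M[R]_(k, m)) (h : 'cV[R]_m).
(** All generators lie on one hyperplane at height 1, so the coefficients of a linear relation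
    between them sum to zero. *)
Hypothesis W_height : W *m h = const_mx 1.
Implicit Types (I J : {set 'I_k}) (l u : 'rV[R]_k) (c : 'cV[R]_k).

Definition cone : set 'rV[R]_m :=
  [set x | exists2 l : 'rV[R]_k, (forall i, 0 <= l 0 i) & x = l *m W].

Definition open_cone : set 'rV[R]_m :=
  [set x | exists2 l : 'rV[R]_k, (forall i, 0 < l 0 i) & x = l *m W].

Definition supported I l := forall i, i \notin I -> l 0 i = 0.

Definition independent I :=
  forall l, supported I l -> l *m W = 0 -> l = 0.

(** Row [i] of [N] expresses the [i]-th generator through those in [I]. Keeping [N] of size [k] by
    [k], padded with zeros, makes coefficient vectors for different bases directly comparable. *)
Definition coord_spec I (N : 'M[R]_k) :=
  N *m W = W /\ forall i j, j \notin I -> N i j = 0.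

Definition basis I := independent I /\ exists N, coord_spec I N.

(* [l *m coord I] is the coefficient vector of [l *m W] in the basis [I]. *)
Definition coord I : 'M[R]_k := xget 0 (coord_spec I).

Lemma supportedD I l u : supported I l -> supported I u -> supported I (l + u).
Proof. by move=> Il Iu i iI; rewrite mxE Il // Iu // addr0. Qed.

Lemma supportedN I l : supported I l -> supported I (- l).
Proof. by move=> Il i iI; rewrite mxE Il // oppr0. Qed.

Lemma independent_inj I l u : independent I ->
  supported I l -> supported I u -> l *m W = u *m W -> l = u.
Proof.
move=> indI Il Iu eq_lu; apply/eqP; rewrite -subr_eq0; apply/eqP.
by apply: indI; [exact/supportedD/supportedN | rewrite mulmxBl eq_lu subrr].
Qed.

Section BasisTheory.
Variable I : {set 'I_k}.
Hypothesis basisI : basis I.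

Lemma coordP : coord_spec I (coord I).
Proof. by case: basisI => _ exN; apply: xgetPex. Qed.

Lemma coordW : coord I *m W = W. Proof. by case: coordP. Qed.

Lemma coordW_row l : l *m coord I *m W = l *m W.
Proof. by rewrite -mulmxA coordW. Qed.

Lemma coord_supported l : supported I (l *m coord I).
Proof.
move=> j jI; rewrite mxE big1 // => i _.
by case: coordP => _ ->; rewrite ?mulr0.
Qed.

Lemma coord_uniq l u : supported I u -> u *m W = l *m W -> l *m coord I = u.
Proof.
case: basisI => indI _ Iu uW; apply: (independent_inj indI) => //.
  exact: coord_supported.
by rewrite coordW_row.
Qed.

Lemma coord_id l : supported I l -> l *m coord I = l.
Proof. by move=> Il; apply: coord_uniq. Qed.

Lemma coord_eq l u : l *m W = u *m W -> l *m coord I = u *m coord I.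
Proof.
by move=> eqW; apply: coord_uniq; [exact: coord_supported | rewrite coordW_row].
Qed.

Lemma coord_row j : j \in I -> row j (coord I) = delta_mx 0 j.
Proof.
move=> jI; rewrite rowE coord_id // => i iI; rewrite mxE /=.
by case: eqP iI => // ->; rewrite jI.
Qed.

Lemma coord_diag i j : i \in I -> coord I i j = (i == j)%:R.
Proof. by move=> /coord_row/rowP/(_ j); rewrite !mxE eq_sym. Qed.

Lemma coord_off i j : j \notin I -> coord I i j = 0.
Proof. by move=> jI; case: coordP => _ ->. Qed.

End BasisTheory.

(** * Caratheodory's theorem with a cost, and extension to bases *)

Definition supp l : {set 'I_k} := [set i | l 0 i != 0].

Lemma supported_supp l : supported (supp l) l.
Proof. by move=> i; rewrite inE negbK => /eqP. Qed.

Lemma sum_dependency l : l *m W = 0 -> \sum_i l 0 i = 0.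
Proof.
move=> lW; have /matrixP/(_ 0 0) : l *m W *m h = 0 by rewrite lW mul0mx.
rewrite -mulmxA W_height !mxE => e; rewrite -[RHS]e.
by apply: eq_bigr => i _; rewrite mxE mulr1.
Qed.

(** If the support is dependent, some nonzero relation [u] on it has cost at most 0, up to sign.
    Adding a multiple of [u] until a first coefficient vanishes shrinks the support and does not
    raise the cost. *)
Lemma caratheodory c l : (forall i, 0 <= l 0 i) ->
  exists2 u : 'rV[R]_k, (forall i, 0 <= u 0 i) &
    [/\ independent (supp u), u *m W = l *m W & (u *m c) 0 0 <= (l *m c) 0 0].
Proof.
have [s] := ubnP #|supp l|; elim: s => // s IHs in l *.
rewrite ltnS => card_l l_ge0.
have [ind|dep] := pselect (independent (supp l)); first by exists l.
have [u [supp_u uW u_neq0 uc]] : exists u,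
    [/\ supported (supp l) u, u *m W = 0, u != 0 & (u *m c) 0 0 <= 0].
  have [u [su uW /eqP u0]] : exists u,
      [/\ supported (supp l) u, u *m W = 0 & u <> 0].
    apply: contrapT => /forallNP no; apply: dep => u su uW.
    by apply: contrapT => u0; apply: (no u).
  have [uc|uc] := leP ((u *m c) 0 0) 0; first by exists u.
  exists (- u); split; first exact: supportedN.
  - by rewrite mulNmx uW oppr0.
  - by rewrite oppr_eq0.
  - by rewrite mulNmx mxE oppr_le0 ltW.
(* The entries of [u] sum to zero and are not all zero. *)
have /existsP[i0 ui0] : [exists i, u 0 i < 0].
  apply: contraT => /existsPn no; case/negP: u_neq0; apply/eqP/rowP => i.
  rewrite mxE; apply/eqP; move: (sum_dependency uW) => /eqP.
  rewrite psumr_eq0 => [/allP/(_ i)|j _]; last by rewrite leNgt no.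
  by rewrite mem_index_enum => /(_ isT).
(* The smallest ratio is the largest multiple of [u] that keeps all coefficients nonnegative; it
   cancels the one at [i1]. *)
case: (@arg_minP _ _ _ i0 (fun i => u 0 i < 0) (fun i => l 0 i / - u 0 i)) =>
  // i1 ui1 min_i1.
pose r := l 0 i1 / - u 0 i1; pose l' := l + r *: u.
have r_ge0 : 0 <= r by rewrite divr_ge0 // oppr_ge0 ltW.
have l'i1 : l' 0 i1 = 0.
  by rewrite !mxE /r invrN mulrN mulNr divfK ?subrr // lt_eqF.
have l'_ge0 i : 0 <= l' 0 i.
  rewrite !mxE; have [ui|ui] := leP 0 (u 0 i).
    by rewrite addr_ge0 // mulr_ge0.
  have := min_i1 i ui; rewrite -/r ler_pdivlMr ?oppr_gt0 // mulrN.
  by rewrite -subr_ge0 opprK.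
have li1 : i1 \in supp l.
  by apply: contraTT ui1 => /supp_u ->; rewrite ltxx.
have [|u' u'_ge0 [ind u'W u'c]] := IHs l' _ l'_ge0.
  apply: leq_trans card_l; apply: proper_card; apply/properP; split.
    apply/fintype.subsetP => i; apply: contraTT => il; rewrite inE negbK !mxE.
    by rewrite supp_u // supported_supp // mulr0 addr0.
  by exists i1 => //; rewrite inE l'i1 eqxx.
exists u' => //; split=> //.
  by rewrite u'W mulmxDl -scalemxAl uW scaler0 addr0.
apply: le_trans u'c _; rewrite mulmxDl -scalemxAl mxE gerDl mxE.
by rewrite mulr_ge0_le0.
Qed.

(** A maximal independent set containing [J] spans: adjoining a further [j] creates a relation whose
    coefficient at [j] is nonzero. *)
Lemma basis_extension J : independent J -> exists2 I, basis I & J \subset I.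
Proof.
move=> indJ; have pJ : `[< independent J >] by apply/asboolP.
have [I /maxsetP[/asboolP indI maxI] JI] :=
  maxset_exists (P := fun I => `[< independent I >]) pJ.
exists I => //; split=> //.
have spanI j : exists l, supported I l /\ row j W = l *m W.
  have [jI|jI] := boolP (j \in I).
    exists (delta_mx 0 j); rewrite rowE; split=> // i iI; rewrite mxE /=.
    by case: eqP iI => // ->; rewrite jI.
  have [l [supp_l lW l_neq0]] : exists l,
      [/\ supported (j |: I) l, l *m W = 0 & l <> 0].
    apply: contrapT => /forallNP no.
    suff /asboolP/maxI e : independent (j |: I).
      by move: jI; rewrite -(e (finset.subsetUr _ _)) setU11.
    by move=> l sl lW; apply: contrapT => l0; apply: (no l).
  have lj : l 0 j != 0.
    apply/eqP => lj0; apply: l_neq0; apply: indI => // i iI.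
    have [->//|ij] := eqVneq i j.
    by apply: supp_l; rewrite !inE negb_or ij.
  exists (delta_mx 0 j - (l 0 j)^-1 *: l); split.
    move=> i iI; rewrite !mxE /=; have [->|ij] := eqVneq i j.
      by rewrite mulVf // subrr.
    have -> : l 0 i = 0 by apply: supp_l; rewrite !inE negb_or ij.
    by rewrite mulr0 subr0.
  by rewrite mulmxBl -scalemxAl lW scaler0 subr0 rowE.
have /choice[f fP] := spanI.
exists (\matrix_(i, j) f i 0 j); split=> [|i j jI].
  apply/row_matrixP => i; rewrite row_mul (_ : row i _ = f i).
    by case: (fP i) => _ ->.
  by apply/rowP => j; rewrite !mxE.
by rewrite mxE; case: (fP i) => /(_ _ jI).
Qed.

(** The point [l *m W] lies off every facet hyperplane of every simplicial cone spanned by a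
    basis. *)
Definition generic l :=
  forall I, basis I -> forall i, i \in I -> (l *m coord I) 0 i != 0.

Lemma genericN l : generic l -> generic (- l).
Proof. by move=> gl I bI i iI; rewrite mulNmx mxE oppr_eq0 gl. Qed.

(** A point of the moment curve works: its [i]-th coordinate in a basis [I] containing [i] is a
    polynomial in [tau] whose coefficient at degree [i] is [coord I i i = 1]. *)
Lemma exists_generic : exists2 l : 'rV[R]_k, (forall i, 0 < l 0 i) & generic l.
Proof.
pose p (x : {set 'I_k} * 'I_k) : {poly R} :=
  \poly_(i < k) (if insub i is Some i' then coord x.1 i' x.2 else 0).
pose S (x : {set 'I_k} * 'I_k) := `[< basis x.1 >] && (x.2 \in x.1).
have pE x (tau : R) :
    (p x).[tau] = ((\row_i tau ^+ i) *m coord x.1) 0 x.2.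
  rewrite /p horner_poly mxE; apply: eq_bigr => i _.
  by rewrite valK mxE mulrC.
have [x /andP[/asboolP bI xI]|tau tau_gt0 ptau] := @generic_positive R _ S p.
  apply/eqP => /polyP/(_ x.2)/eqP.
  by rewrite coef_poly ltn_ord valK coef0 coord_diag // eqxx oner_eq0.
exists (\row_i tau ^+ i) => [i|I bI i iI]; first by rewrite mxE exprn_gt0.
by rewrite -(pE (I, i)) ptau // /S /= iI andbT; apply/asboolP.
Qed.

(* Reduced cost of the [j]-th generator with respect to the basis [I]. *)
Definition reduced c I j : R := (c - coord I *m c) j 0.

(** Again on the moment curve: the reduced cost at [j] outside [I] is a polynomial in [tau] with
    coefficient [1 - coord I j j = 1] at degree [j]. *)
Lemma exists_generic_cost :
  exists c, forall I, basis I -> forall j, j \notin I -> reduced c I j != 0.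
Proof.
pose p (x : {set 'I_k} * 'I_k) : {poly R} := \poly_(i < k)
  (if insub i is Some i' then (1%:M - coord x.1) x.2 i' else 0).
pose S (x : {set 'I_k} * 'I_k) := `[< basis x.1 >] && (x.2 \notin x.1).
have pE x (tau : R) :
    (p x).[tau] = reduced (\col_i tau ^+ i) x.1 x.2.
  rewrite /reduced -[X in (X - _)]mul1mx -mulmxBl.
  rewrite /p horner_poly mxE; apply: eq_bigr => i _.
  by rewrite valK [X in _ = _ * X]mxE.
have [x /andP[/asboolP bI xI]|tau tau_gt0 ptau] := @generic_positive R _ S p.
  apply/eqP => /polyP/(_ x.2)/eqP.
  rewrite coef_poly ltn_ord valK coef0 !mxE eqxx coord_off // subr0.
  by rewrite oner_eq0.
exists (\col_i tau ^+ i) => I bI j jI.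
by rewrite -(pE (I, j)) ptau // /S /= jI andbT; apply/asboolP.
Qed.

(** * Optimal bases and the half-open cells of the triangulation *)

Section Optimal.
Variable c : 'cV[R]_k.
Hypothesis c_generic :
  forall I, basis I -> forall j, j \notin I -> reduced c I j != 0.

(* The optimal bases are the maximal cones of a regular triangulation. *)
Definition optimal I := basis I /\ forall j, j \notin I -> 0 < reduced c I j.

Lemma reduced_basis I j : basis I -> j \in I -> reduced c I j = 0.
Proof.
move=> bI jI; rewrite /reduced.
have -> : (c - coord I *m c) j 0 = row j (c - coord I *m c) 0 0.
  by rewrite [RHS]mxE.
by rewrite linearB /= row_mul coord_row // -rowE subrr mxE.
Qed.

(** The reduced costs vanish on [I], so only coefficients outside [I] contribute to the
    difference. *)
Lemma cost_decomposition I l : basis I ->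
  (l *m c) 0 0 =
  (l *m coord I *m c) 0 0 + \sum_(j in ~: I) l 0 j * reduced c I j.
Proof.
move=> bI; apply/eqP; rewrite addrC -subr_eq; apply/eqP.
transitivity ((l *m (c - coord I *m c)) 0 0).
  by rewrite mulmxBr mulmxA [RHS]mxE [X in _ = _ + X]mxE.
rewrite mxE (bigID (mem I)) /= big1 ?add0r => [|j jI].
  by apply: eq_big => [j|j jI]; rewrite ?inE.
by rewrite -/(reduced c I j) reduced_basis // mulr0.
Qed.

Lemma optimal_minimal I l : optimal I -> (forall i, 0 <= l 0 i) ->
  (l *m coord I *m c) 0 0 <= (l *m c) 0 0
    ?= iff [forall j, (j \notin I) ==> (l 0 j == 0)].
Proof.
move=> [bI red_gt0] l_ge0.
have term_ge0 j : j \in ~: I -> 0 <= l 0 j * reduced c I j.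
  by rewrite inE => jI; rewrite mulr_ge0 // ltW // red_gt0.
split; first by rewrite [leRHS](cost_decomposition l bI) lerDl sumr_ge0.
rewrite [X in _ == X](cost_decomposition l bI).
rewrite -[X in X == _]addr0 (inj_eq (addrI _)) eq_sym psumr_eq0 //.
apply/allP/forallP => [all0 j|all0 j _]; apply/implyP; rewrite ?inE => jI.
  have /implyP := all0 j (mem_index_enum j); rewrite inE => /(_ jI).
  by rewrite mulf_eq0 (gt_eqF (red_gt0 j jI)) orbF.
by rewrite mulf_eq0 (implyP (all0 j)).
Qed.

(** The two basic representations of the same point both have minimal cost, so the equality case of
    [optimal_minimal] puts the support of the second inside [I]. That support is all of [J];
    symmetry concludes. *)
Lemma optimal_uniq I J l : optimal I -> optimal J ->
  (forall i, i \in I -> 0 < (l *m coord I) 0 i) ->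
  (forall i, i \in J -> 0 < (l *m coord J) 0 i) -> I = J.
Proof.
wlog suff half : I J / optimal I -> optimal J ->
    (forall i, i \in I -> 0 < (l *m coord I) 0 i) ->
    (forall i, i \in J -> 0 < (l *m coord J) 0 i) -> J \subset I.
  by move=> oI oJ lI lJ; apply/eqP; rewrite finset.eqEsubset !half.
move=> oI oJ lI lJ; have [bI _] := oI; have [bJ _] := oJ.
have ge0 K : basis K -> (forall i, i \in K -> 0 < (l *m coord K) 0 i) ->
    forall i, 0 <= (l *m coord K) 0 i.
  move=> bK lK i; have [/lK/ltW//|iK] := boolP (i \in K).
  by rewrite (coord_supported bK).
have IJ := optimal_minimal oI (ge0 J bJ lJ).
have JI := optimal_minimal oJ (ge0 I bI lI).
rewrite (coord_eq bI (coordW_row bJ l)) in IJ.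
rewrite (coord_eq bJ (coordW_row bI l)) in JI.
have /forallP supJ : [forall j, (j \notin I) ==> ((l *m coord J) 0 j == 0)].
  by rewrite -(IJ.2) eq_le IJ JI.
apply/fintype.subsetP => j jJ; apply: contraTT (lJ j jJ) => jI.
by rewrite (eqP (implyP (supJ j) jI)) ltxx.
Qed.

(** Simplex method: a feasible basis of least cost is optimal, since bringing in a generator of
    negative reduced cost would lower the cost. Genericity makes the basic coordinates strictly
    positive, which leaves room for that exchange. *)
Lemma optimal_exists l : generic l -> cone (l *m W) ->
  exists2 I, optimal I & forall i, i \in I -> 0 < (l *m coord I) 0 i.
Proof.
move=> gen_l [l0 l0_ge0 l0W].
pose feasible I := `[< basis I >] && [forall i, 0 <= (l *m coord I) 0 i].
have improve u : (forall i, 0 <= u 0 i) -> u *m W = l *m W ->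
    exists2 I, feasible I & (l *m coord I *m c) 0 0 <= (u *m c) 0 0.
  move=> u_ge0 uW; have [v v_ge0 [indv vW vc]] := caratheodory c u_ge0.
  have [I bI supv] := basis_extension indv.
  have vI : l *m coord I = v.
    apply: coord_uniq => //; last by rewrite vW uW.
    move=> i iI; apply: supported_supp; apply: contra iI.
    exact: (fintype.subsetP supv).
  exists I; rewrite ?vI //; apply/andP; split; first exact/asboolP.
  by apply/forallP => i; rewrite vI.
have [I0 fI0 _] := improve l0 l0_ge0 (esym l0W).
case: (@arg_minP _ _ _ I0 feasible (fun I => (l *m coord I *m c) 0 0) fI0) =>
  I /andP[/asboolP bI /forallP lI_ge0] minI.
have lI i : i \in I -> 0 < (l *m coord I) 0 i.
  by move=> iI; rewrite lt_def lI_ge0 andbT; apply: gen_l.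
exists I => //; split=> // j jI; rewrite lt_def c_generic //= leNgt.
apply/negP => rj_lt0.
(* The value 1 outside [I] is a placeholder that keeps [a] positive. *)
pose a i := if i \in I then (l *m coord I) 0 i else 1.
have [i|e e_gt0 small] := @small_perturbation R _ a (fun i => coord I j i).
  by rewrite /a; case: ifP => // /lI.
(* [u] represents the same point: [e] times the [j]-th generator is added and its expansion in the
   basis is subtracted. *)
pose u := l *m coord I + e *: (delta_mx 0 j - row j (coord I)).
have u_ge0 i : 0 <= u 0 i.
  rewrite !mxE /=; have [iI|iI] := boolP (i \in I).
    have := small i e; rewrite e_gt0 lexx /a iI => /(_ isT)/ltW.
    rewrite mxE; case: eqP iI jI => [->->//|_ _ _].
    rewrite sub0r mulrN => /le_trans; apply; rewrite lerB // ler_pM2l //.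
    exact: ler_norm.
  rewrite (coord_off bI) // subr0; have := coord_supported bI l iI.
  by rewrite mxE => ->; rewrite add0r mulr_ge0 // ltW.
have [|K /minI leK leu] := improve u u_ge0.
  rewrite mulmxDl coordW_row // -scalemxAl mulmxBl -row_mul coordW //.
  by rewrite rowE subrr scaler0 addr0.
have := le_trans leK leu; apply/negP; rewrite -ltNge.
rewrite mulmxDl [ltLHS]mxE gtrDl -scalemxAl mxE pmulr_rlt0 //.
rewrite mulmxBl -row_mul -rowE -linearB /=.
by rewrite mxE.
Qed.

(** [s] marks the facets that belong to the half-open simplicial cone. *)
Definition cell I (s : pred 'I_k) : set 'rV[R]_m := [set x | exists l : 'rV[R]_k,
  [/\ supported I l, x = l *m W &
      forall i, i \in I -> if s i then 0 <= l 0 i else 0 < l 0 i]].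

(** A facet is kept when a small move along [l] leads from it to the inner side of its
    hyperplane. *)
Definition direction l I : pred 'I_k := fun i => 0 < (l *m coord I) 0 i.

Lemma cellE I s l : basis I -> cell I s (l *m W) <->
  forall i, i \in I ->
    if s i then 0 <= (l *m coord I) 0 i else 0 < (l *m coord I) 0 i.
Proof.
move=> bI; split=> [[u [Iu uW us]]|ls]; last first.
  exists (l *m coord I); split=> //; first exact: coord_supported.
  by rewrite coordW_row.
by rewrite (coord_uniq bI Iu).
Qed.

Lemma directionN l I i : generic l -> basis I -> i \in I ->
  direction (- l) I i = ~~ direction l I i.
Proof.
move=> gl bI iI; rewrite /direction mulNmx mxE oppr_gt0 -leNgt.
by rewrite lt_neqAle gl.
Qed.

(** A small multiple of [g] preserves the sign of every nonzero coordinate and gives the zero ones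
    the sign of [g]. Lying in a half-open cell thus becomes lying, after the move, in the open
    simplicial cone, with one [e] for all bases. *)
Lemma perturb_sign (g l : 'rV[R]_k) (e0 : R) : generic g -> 0 < e0 ->
  exists e, [/\ 0 < e <= e0, generic (l + e *: g) &
    forall I, basis I -> cell I (direction g I) (l *m W) <->
      forall i, i \in I -> 0 < ((l + e *: g) *m coord I) 0 i].
Proof.
move=> gen_g e0_gt0.
(* A zero coordinate imposes no bound on [e], hence the value 1. *)
pose a (x : {set 'I_k} * 'I_k) :=
  if (l *m coord x.1) 0 x.2 == 0 then 1 else `|(l *m coord x.1) 0 x.2|.
have [x|e1 e1_gt0 small] := @small_perturbation R _ a
    (fun x => (g *m coord x.1) 0 x.2).
  by rewrite /a; case: ifP => // /negbT; rewrite normr_gt0.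
exists (Num.min e0 e1); set e := Num.min e0 e1.
have e_gt0 : 0 < e by rewrite lt_min e0_gt0.
have entryE I i : ((l + e *: g) *m coord I) 0 i =
    (l *m coord I) 0 i + e * (g *m coord I) 0 i.
  by rewrite mulmxDl -scalemxAl mxE [X in _ + X]mxE.
have dom I i : (l *m coord I) 0 i != 0 ->
    e * `|(g *m coord I) 0 i| < `|(l *m coord I) 0 i|.
  move=> /negPf l0; have := small (I, i) e; rewrite /a /= l0 subr_gt0; apply.
  by rewrite e_gt0 ge_min lexx orbT.
have signE I i : basis I -> i \in I ->
    (((l + e *: g) *m coord I) 0 i != 0) *
    ((0 < ((l + e *: g) *m coord I) 0 i) =
     if direction g I i then 0 <= (l *m coord I) 0 i else 0 < (l *m coord I) 0 i).
  move=> bI iI; rewrite /direction entryE.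
  move: (gen_g I bI i iI) (dom I i).
  move: ((l *m coord I) 0 i) ((g *m coord I) 0 i) => u v.
  move=> v_neq0; have [->|u_neq0 /(_ isT)] := eqVneq u 0.
    rewrite add0r (pmulr_rgt0 _ e_gt0) lexx ltxx.
    by split; [rewrite mulf_neq0 // gt_eqF | case: ifP].
  have [v_gt0|v_lt0|v0] := ltgtP 0 v; last by rewrite -v0 eqxx in v_neq0.
  - rewrite (gtr0_norm v_gt0) => lt_ev; have ev := mulr_gt0 e_gt0 v_gt0.
    have [u_ge0|u_lt0] := leP 0 u.
      by have pos : 0 < u + e * v by [lra]; rewrite gt_eqF.
    rewrite (ltr0_norm u_lt0) in lt_ev.
    by have neg : u + e * v < 0 by [lra]; rewrite lt_eqF // le_gtF // ltW.
  - rewrite (ltr0_norm v_lt0) mulrN => lt_ev.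
    have ev : e * v < 0 by rewrite pmulr_rlt0.
    have [u_gt0|u_lt0|u0] := ltgtP 0 u; last by rewrite -u0 eqxx in u_neq0.
      rewrite (gtr0_norm u_gt0) in lt_ev.
      by have pos : 0 < u + e * v by [lra]; rewrite gt_eqF.
    by have neg : u + e * v < 0 by [lra]; rewrite lt_eqF // le_gtF // ltW.
split.
- by rewrite e_gt0 ge_min lexx.
- by move=> I bI i iI; rewrite signE.
- move=> I bI; rewrite cellE //; split=> cI i iI; first by rewrite signE // cI.
  by rewrite -signE // cI.
Qed.

Lemma cell_exists g x (e0 : R) : generic g -> 0 < e0 ->
  (forall e, 0 < e <= e0 -> cone (x + e *: (g *m W))) ->
  exists2 I, optimal I & cell I (direction g I) x.
Proof.
move=> gen_g e0_gt0 cx; have [l xl] : exists l : 'rV[R]_k, x = l *m W.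
  have [|l _ xl] := cx e0; first by rewrite e0_gt0 lexx.
  by exists (l - e0 *: g); rewrite mulmxBl -xl -scalemxAl addrK.
have [e [e_e0 gen_e cellP]] := perturb_sign l gen_g e0_gt0.
have [|I oI posI] := optimal_exists gen_e.
  by rewrite mulmxDl -scalemxAl -xl; apply: cx.
by exists I => //; rewrite xl cellP //; case: oI.
Qed.

(** One small move puts the point inside both open simplicial cones, where the optimal basis is
    unique. *)
Lemma cell_uniq g x I J : generic g -> optimal I -> optimal J ->
  cell I (direction g I) x -> cell J (direction g J) x -> I = J.
Proof.
move=> gen_g oI oJ cI cJ; have [l [_ xl _]] := cI; rewrite {}xl in cI cJ.
have [e [_ _ cellP]] := perturb_sign l gen_g ltr01.
have [bI _] := oI; have [bJ _] := oJ.
by apply: (optimal_uniq oI oJ); apply/cellP.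
Qed.

Lemma cell_cone I s x : cell I s x -> cone x.
Proof.
move=> [l [Il -> ls]]; exists l => // i.
have [iI|iI] := boolP (i \in I); last by rewrite Il.
by have := ls i iI; case: ifP => // _ /ltW.
Qed.

Section PositiveDirection.
Variable g : 'rV[R]_k.
Hypotheses (g_gt0 : forall i, 0 < g 0 i) (gen_g : generic g).

Lemma cone_cell x : cone x ->
  exists2 I, optimal I & cell I (direction g I) x.
Proof.
move=> [l l_ge0 ->]; apply: (cell_exists gen_g ltr01) => e /andP[e_gt0 _].
exists (l + e *: g); last by rewrite mulmxDl -scalemxAl.
by move=> i; rewrite !mxE addr_ge0 // mulr_ge0 // ltW.
Qed.

Lemma open_cone_cell x : open_cone x ->
  exists2 I, optimal I & cell I (direction (- g) I) x.
Proof.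
move=> [l l_gt0 ->]; have [e e_gt0 small] := small_perturbation (g 0) l_gt0.
apply: (cell_exists (genericN gen_g) e_gt0) => s s_e.
exists (l - s *: g); last by rewrite mulmxBl mulNmx scalerN -scalemxAl.
by move=> i; rewrite !mxE ltW // -[g 0 i]gtr0_norm // small.
Qed.

(** After a move by [- e *: g] the point has nonnegative coefficients in the basis [I]; moving back
    adds [e *: g], which makes all coefficients positive, also those outside [I]. *)
Lemma cell_open_cone I x : optimal I -> cell I (direction (- g) I) x ->
  open_cone x.
Proof.
move=> [bI _] cI; have [l [Il xl _]] := cI; rewrite {}xl in cI *.
have [e [/andP[e_gt0 _] _ cellP]] := perturb_sign l (genericN gen_g) ltr01.
exists ((l + e *: - g) *m coord I + e *: g) => [i|].
  rewrite mxE [X in _ + X]mxE ltr_wpDl ?mulr_gt0 //.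
  have [iI|iI] := boolP (i \in I); last by rewrite (coord_supported bI).
  by apply/ltW; move: i iI; apply/cellP.
by rewrite mulmxDl coordW_row // -mulmxDl -addrA scalerN addNr addr0.
Qed.

End PositiveDirection.
End Optimal.

(** With the selection matrix [E], [N = N *m E^T *m E], so [W] factors through [E *m W], whose
    [#|I|] rows are independent. *)
Lemma card_basis I : basis I -> #|I| = \rank W.
Proof.
move=> [indI [N [NW N0]]]; pose E : 'M[R]_(#|I|, k) := rowsub enum_val 1%:M.
have EE j i : E j i = (enum_val j == i)%:R by rewrite !mxE.
have NE : N *m E^T *m E = N.
  rewrite -mulmxA; apply/matrixP => a i; rewrite mxE.
  have EtE i' : (E^T *m E) i' i = ((i' == i) && (i \in I))%:R.
    have [iI|iI] := boolP (i \in I); rewrite mxE.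
      rewrite (bigD1 (enum_rank_in iI i)) //= mxE !EE enum_rankK_in //.
      rewrite eqxx mulr1 andbT eq_sym big1 ?addr0 // => j jr.
      rewrite mxE !EE [X in _ * X](_ : _ = 0) ?mulr0 //.
      by case: eqP => // ji; subst i; rewrite enum_valK_in eqxx in jr.
    rewrite andbF big1 // => j _; rewrite !EE.
    by case: eqP iI => [<-|_ _]; rewrite ?enum_valP ?mulr0.
  rewrite (bigD1 i) //= EtE eqxx big1 => [|i' /negPf ii']; last first.
    by rewrite EtE ii' mulr0.
  by have [iI|iI] := boolP (i \in I); rewrite ?mulr1 ?addr0 // N0 ?mulr0 ?addr0.
have freeE : row_free (E *m W).
  apply: inj_row_free => v; rewrite mulmxA => vEW.
  suff vE : v *m E = 0.
    apply/rowP => j; move/rowP/(_ (enum_val j)): vE; rewrite !mxE => <-.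
    rewrite (bigD1 j) //= EE eqxx mulr1 big1 ?addr0 // => j' jj'.
    by rewrite EE (inj_eq enum_val_inj) (negPf jj') mulr0.
  apply: indI => // i iI; rewrite mxE big1 // => j _; rewrite EE.
  by case: eqP iI => [<-|_ _]; rewrite ?enum_valP ?mulr0.
rewrite -(eqP freeE); apply/eqP; rewrite eqn_leq mxrankM_maxr.
by rewrite -{1}NW -NE -!mulmxA mulmxA mxrankM_maxr.
Qed.

End Cones.

(** * Lattice points of half-open cones *)

Lemma ncard_bij (T U : choiceType) (A : set T) (B : set U) (f : T -> U) :
  finite_set A -> (forall x, A x -> B (f x)) ->
  (forall x y, A x -> A y -> f x = f y -> x = y) ->
  (forall y, B y -> exists2 x, A x & f x = y) -> ncard A = ncard B.
Proof.
move=> finA fAB injf surf; have -> : B = f @` A.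
  by apply/seteqP; split=> [y /surf[x Ax <-]|_ [x Ax <-]]; [exists x | apply: fAB].
rewrite /ncard fset_set_image // card_in_imfset //= => x y.
by rewrite !in_fset_set // !inE; apply: injf.
Qed.

Lemma ncard_finType (T : finType) (P : pred T) :
  ncard [set x | P x] = #|[set x | P x]%SET|.
Proof.
rewrite cardE; apply: perm_size; apply: uniq_perm => [||x].
- exact: fset_uniq.
- exact: enum_uniq.
- rewrite in_fset_set; last exact: finite_finset.
  by rewrite mem_enum finset.inE; apply/idP/idP; rewrite inE.
Qed.

Lemma ncard_partition (T I : choiceType) (A : set T) (B : I -> set T) (s : seq I) :
  finite_set A -> uniq s -> (forall i x, i \in s -> B i x -> A x) ->
  (forall x, A x -> exists2 i, i \in s & B i x) ->
  (forall i j x, i \in s -> j \in s -> B i x -> B j x -> i = j) ->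
  ncard A = (\sum_(i <- s) ncard (B i))%N.
Proof.
move=> finA uniqs BA AB dis.
have ncardE i : i \in s ->
    ncard (B i) = (\sum_(x <- fset_set A) (x \in B i))%N.
  move=> si; have finB : finite_set (B i).
    by apply: sub_finite_set finA => x; apply: BA.
  rewrite -[RHS]big_mkcond /= sum1_count -size_filter; apply: perm_size.
  apply: uniq_perm => [||x]; rewrite ?filter_uniq ?fset_uniq //.
  rewrite mem_filter !in_fset_set //; apply/idP/andP => [|[]//].
  by rewrite !inE => Bx; split=> //; apply: BA Bx.
rewrite (eq_big_seq _ ncardE) exchange_big /= /ncard -sum1_size.
apply: eq_big_seq => x; rewrite in_fset_set // inE => /AB[i si Bix].
rewrite (bigD1_seq i) //= mem_set // big1_seq // => j /andP[ji sj].
apply/eqP; rewrite eqb0; apply: contra ji; rewrite inE => Bjx.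
by apply/eqP; apply: dis Bjx Bix.
Qed.

Section Lattice.
Variables (R : realType) (k m : nat) (W : 'M[int]_(k, m)) (h : 'cV[int]_m).
Hypothesis W_height : W *m h = const_mx 1.
Local Notation WR := (map_mx (@intmul R 1) W).
Local Notation lp := (@lattice_point R m).
Implicit Types (x b : 'rV[int]_m).

Lemma lattice_point_inj : injective lp.
Proof.
move=> x y /rowP xy; apply/rowP => i; have := xy i.
by rewrite !mxE => /intr_inj.
Qed.

Definition height x : int := (x *m h) 0 0.

Lemma heightD x y : height (x + y) = height x + height y.
Proof. by rewrite /height mulmxDl mxE. Qed.

Lemma height_mul (v : 'rV[int]_k) : height (v *m W) = \sum_i v 0 i.
Proof.
rewrite /height -mulmxA W_height mxE.
by apply: eq_bigr => i _; rewrite mxE mulr1.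
Qed.

Lemma height_real x (l : 'rV[R]_k) : lp x = l *m WR ->
  (height x)%:~R = \sum_i l 0 i.
Proof.
move=> xl; have -> : (height x)%:~R = (lp x *m map_mx intr h) 0 0.
  by rewrite /lattice_point -map_mxM mxE.
rewrite xl -mulmxA -map_mxM W_height mxE.
by apply: eq_bigr => i _; rewrite !mxE mulr1.
Qed.

Lemma finite_bounded_lattice (M : nat) :
  finite_set [set x : 'rV[int]_m | forall j, `|x 0 j| <= M%:Z].
Proof.
pose f (u : {ffun 'I_m -> 'I_(M + M).+1}) : 'rV[int]_m := \row_j ((u j)%:Z - M%:Z).
apply: (@sub_finite_set _ _ (range f)); last exact/finite_image/finite_finset.
move=> x /= xM; exists [ffun j => inord (absz (x 0 j + M%:Z))] => //.
apply/rowP => j; rewrite mxE ffunE; have := xM j.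
rewrite ler_norml => /andP[lo hi].
by rewrite inordK; lia.
Qed.

Lemma finite_combinations (M : nat) : finite_set
  [set x | exists2 l : 'rV[R]_k, (forall i, 0 <= l 0 i <= M%:R) & lp x = l *m WR].
Proof.
pose B := (\max_j (\sum_i M * `|W i j|%N))%N.
apply: sub_finite_set (finite_bounded_lattice B) => x [l lM /rowP xl] j.
suff : `|x 0 j|%:~R <= (\sum_i M * `|W i j|%N)%N%:R :> R.
  rewrite -[leRHS]/((_ : nat)%:Z%:~R) ler_int => /le_trans; apply.
  rewrite lez_nat; exact: (leq_bigmax j).
have := xl j; rewrite [LHS]mxE [RHS]mxE => xj.
rewrite intr_norm xj natr_sum; apply: le_trans (ler_norm_sum _ _ _) _.
apply: ler_sum => i _; rewrite normrM natrM.
have /andP[l0 l1] := lM i.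
by rewrite (ger0_norm l0) ler_pM // mxE -intr_norm -abszE.
Qed.

Section Cell.
Variables (I : {set 'I_k}) (s : pred 'I_k).
Hypothesis indI : independent WR I.

(** The half-open fundamental parallelepiped: across a removed facet the interval (0,1] replaces
    [0,1), so that nonnegative integer translates tile the cell. *)
Definition box : set 'rV[int]_m := [set b | exists l : 'rV[R]_k,
  [/\ supported I l, lp b = l *m WR & forall i, i \in I ->
      if s i then 0 <= l 0 i < 1 else 0 < l 0 i <= 1]].

Lemma box_bounds (l : 'rV[R]_k) i :
  supported I l -> (forall i, i \in I ->
      if s i then 0 <= l 0 i < 1 else 0 < l 0 i <= 1) ->
  0 <= l 0 i <= (i \in I)%:R.
Proof.
move=> Il ls; have [iI|iI] := boolP (i \in I); last by rewrite Il // lexx.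
by have := ls i iI; case: ifP => _ /andP[]; [move=> -> /ltW | move=> /ltW ->].
Qed.

Lemma finite_box : finite_set box.
Proof.
apply: sub_finite_set (finite_combinations 1) => b [l [Il bl ls]].
exists l => // i; have /andP[-> /le_trans->//] := box_bounds i Il ls.
by rewrite ler_nat; case: (_ \in _).
Qed.

Lemma box_height b : box b -> 0 <= height b <= #|I|%:Z.
Proof.
move=> [l [Il bl ls]]; rewrite -!(ler_int R).
rewrite (height_real bl) sumr_ge0 => [|i _]; last first.
  by have /andP[] := box_bounds i Il ls.
have -> : (#|I|%:Z)%:~R = \sum_i (i \in I)%:R :> R.
  rewrite -[LHS]/(#|I|%:R) -sum1_card natr_sum big_mkcond /=.
  by apply: eq_bigr => i _; case: ifP.
by apply: ler_sum => i _; have /andP[] := box_bounds i Il ls.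
Qed.

Definition int_supported (v : 'rV[int]_k) := forall i, i \notin I -> v 0 i = 0.

Lemma int_supported_inj (u v : 'rV[int]_k) : int_supported u -> int_supported v ->
  u *m W = v *m W -> u = v.
Proof.
move=> Iu Iv uv; have : map_mx intr u = map_mx intr v :> 'rV[R]_k.
  apply: (independent_inj indI) => [i iI|i iI|]; rewrite ?mxE ?Iu ?Iv //.
  by rewrite -!map_mxM uv.
by move=> /rowP e; apply/rowP => i; have := e i; rewrite !mxE => /intr_inj.
Qed.

Definition translates b (t : nat) : set 'rV[int]_m := [set x |
  (exists v : 'rV[int]_k, [/\ int_supported v, (forall i, 0 <= v 0 i) &
    x = b + v *m W]) /\ height x <= t%:Z].

Local Notation E := (rowsub enum_val 1%:M : 'M[int]_(#|I|, k)).

Lemma mulmx_enum_val (u : 'rV[int]_#|I|) : int_supported (u *m E) *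
  (forall j, (u *m E) 0 (enum_val j) = u 0 j) *
  (\sum_i (u *m E) 0 i = \sum_j u 0 j).
Proof.
have EE j i : E j i = (enum_val j == i)%:R by rewrite !mxE.
split; [split|].
- move=> i iI; rewrite mxE big1 // => j _; rewrite EE.
  by case: eqP iI => [<-|_ _]; rewrite ?enum_valP // mulr0.
- move=> j; rewrite mxE (bigD1 j) //= EE eqxx mulr1 big1 ?addr0 // => j' jj'.
  by rewrite EE (inj_eq enum_val_inj) (negPf jj') mulr0.
- under eq_bigr do rewrite mxE; rewrite exchange_big /=.
  apply: eq_bigr => j _; rewrite -mulr_sumr (bigD1 (enum_val j)) //= EE eqxx.
  by rewrite big1 ?addr0 ?mulr1 // => i ij; rewrite EE eq_sym (negPf ij).
Qed.

Lemma int_supportedE v : int_supported v ->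
  v = (\row_(j < #|I|) v 0 (enum_val j)) *m E.
Proof.
move=> Iv; apply/rowP => i; have [iI|iI] := boolP (i \in I).
  by rewrite -(enum_rankK_in iI iI) (mulmx_enum_val _).1.2 mxE.
by rewrite Iv // (mulmx_enum_val _).1.1.
Qed.

(** Stars and bars: the translates correspond to nonnegative integer vectors on [I] with sum at most
    [t - height b]. *)
Lemma ncard_translates b t : 0 <= height b <= #|I|%:Z ->
  ncard (translates b t) = 'C(t + #|I| - `|height b|, #|I|).
Proof.
(* If [b] is already too high there is no translate, and the upper index drops below [#|I|]. *)
move=> /andP[hb_ge0 hbI]; have [lt_tb|le_bt] := ltnP t `|height b|%N.
  rewrite bin_small; last by lia.
  rewrite (_ : translates b t = set0) ?/ncard ?fset_set0 ?cardfs0 //.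
  apply/seteqP; split=> // x [[v [_ v_ge0 ->]]]; rewrite heightD height_mul.
  have : 0 <= \sum_i v 0 i by exact: sumr_ge0.
  by rewrite /mkset; lia.
pose N := (t - `|height b|)%N.
have -> : (t + #|I| - `|height b| = #|I| + N)%N by lia.
rewrite -card_partial_ord_partitions.
pose vec (u : #|I|.-tuple 'I_N.+1) : 'rV[int]_#|I| := \row_j (tnth u j)%:Z.
have sum_vec (u : #|I|.-tuple 'I_N.+1) :
    \sum_j vec u 0 j = (\sum_(i <- u) i)%N%:Z.
  rewrite big_tuple (big_morph Posz PoszD (erefl _)).
  by apply: eq_bigr => j _; rewrite mxE.
rewrite -(@ncard_bij _ _ [set u : #|I|.-tuple 'I_N.+1 | (\sum_(i <- u) i <= N)%N]
  _ (fun u => b + vec u *m E *m W)).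
- exact: ncard_finType.
- exact: finite_finset.
- move=> u /= uN; split.
    exists (vec u *m E); split=> //; first exact: (mulmx_enum_val _).1.1.
    move=> i; rewrite mxE sumr_ge0 // => j _.
    by rewrite !mxE mulr_ge0 // ler0n.
  rewrite heightD height_mul (mulmx_enum_val _).2 sum_vec.
  by move: uN; rewrite /N; move: (\sum_(_ <- _) _)%N => S; lia.
- move=> u u' _ _ /addrI/int_supported_inj eq_uu'.
  have {eq_uu'} := eq_uu' (mulmx_enum_val _).1.1 (mulmx_enum_val _).1.1.
  move=> /rowP eq_uu'; apply: eq_from_tnth => j.
  have := eq_uu' (enum_val j); rewrite !(mulmx_enum_val _).1.2 !mxE => -[].
  exact: ord_inj.
- move=> x [[v [Iv v_ge0 ->]]]; rewrite heightD height_mul => hx.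
  have vN i : v 0 i <= N%:Z.
    have : v 0 i <= \sum_i v 0 i by rewrite (bigD1 i) //= lerDl sumr_ge0.
    by lia.
  pose u : #|I|.-tuple 'I_N.+1 := [tuple inord (absz (v 0 (enum_val j))) | j < #|I|].
  have vu : vec u = \row_(j < #|I|) v 0 (enum_val j).
    apply/rowP => j; rewrite !mxE tnth_mktuple inordK ?gez0_abs //.
    by have := vN (enum_val j); have := v_ge0 (enum_val j); lia.
  exists u; last by rewrite vu -int_supportedE.
  suff : (\sum_(i <- u) i)%N%:Z <= N%:Z by rewrite lez_nat.
  rewrite -sum_vec vu -(mulmx_enum_val _).2 -int_supportedE // /N.
  by move: hx le_bt hb_ge0; move: (\sum_i v 0 i) (height b) => S hb; lia.
Qed.

Lemma cell_translates x :
  cell WR I s (lp x) -> exists2 b, box b &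
    exists v : 'rV[int]_k, [/\ int_supported v, (forall i, 0 <= v 0 i) &
      x = b + v *m W].
Proof.
move=> [l [Il xl ls]].
have fl r : exists n : int,
    if s r then 0 <= l 0 r - n%:~R < 1 else 0 < l 0 r - n%:~R <= 1.
  case: (s r).
    exists (Num.floor (l 0 r)); have := floor_itv (l 0 r); rewrite intrD.
    by move=> /andP[? ?]; apply/andP; split; lra.
  (* This is the ceiling minus one, which leaves a remainder in (0,1]. *)
  exists (- Num.floor (- l 0 r) - 1); have := floor_itv (- l 0 r).
  rewrite intrD intrB intrN => /andP[? ?]; apply/andP; split; lra.
have /choice[n nP] := fl.
pose v : 'rV[int]_k := \row_i (if i \in I then n i else 0).
exists (x - v *m W); last first.
  exists v; split; last by rewrite subrK.
  - by move=> i iI; rewrite mxE (negPf iI).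
  - move=> i; rewrite mxE; case: ifP => // iI.
    rewrite -ltzD1 -(ltr_int R) intrD; have := ls i iI; have := nP i.
    by case: (s i) => [/andP[? ?] ?|/andP[? ?] ?]; lra.
exists (l - map_mx intr v); split.
- by move=> i iI; rewrite !mxE Il // (negPf iI) subr0.
- by rewrite /lattice_point map_mxB map_mxM mulmxBl -xl.
- by move=> i iI; rewrite !mxE iI; apply: nP.
Qed.

Lemma translates_cell b (v : 'rV[int]_k) : box b -> int_supported v ->
  (forall i, 0 <= v 0 i) -> cell WR I s (lp (b + v *m W)).
Proof.
move=> [l [Il bl ls]] Iv v_ge0; exists (l + map_mx intr v); split.
- by move=> i iI; rewrite !mxE Il // Iv // addr0.
- by rewrite /lattice_point map_mxD map_mxM mulmxDl -bl.
- move=> i iI; rewrite !mxE; have := ls i iI.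
  have : 0 <= (v 0 i)%:~R :> R by rewrite ler0z.
  by case: (s i) => ? /andP[? ?]; lra.
Qed.

(** By independence the real coefficients agree, so the entries of [v] and [v'] differ by a
    difference of two numbers from the same half-open unit interval, that is, by an integer of
    absolute value below 1. *)
Lemma box_translates_uniq b b' (v v' : 'rV[int]_k) : box b -> box b' ->
  int_supported v -> int_supported v' -> b + v *m W = b' + v' *m W -> b = b'.
Proof.
move=> [l [Il bl ls]] [l' [Il' bl' ls']] Iv Iv' e.
have eql : l + map_mx intr v = l' + map_mx intr v'.
  apply: (independent_inj indI).
  - by move=> i iI; rewrite !mxE Il // Iv // addr0.
  - by move=> i iI; rewrite !mxE Il' // Iv' // addr0.
  - by rewrite !mulmxDl -bl -bl' -!map_mxM -!map_mxD e.
suff vv' : v = v' by move: e; rewrite vv' => /addIr.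
apply/rowP => i; have [iI|iI] := boolP (i \in I); last by rewrite Iv ?Iv'.
have := ls i iI; have := ls' i iI; have /rowP/(_ i) := eql; rewrite !mxE => ei.
move=> h1 h2; apply/eqP; rewrite eq_le -!ltzD1 -!(ltr_int R) !intrD.
by move: h1 h2; case: (s i) => /andP[? ?] /andP[? ?]; apply/andP; split; lra.
Qed.

Lemma ncard_cell t :
  ncard [set x | cell WR I s (lp x) /\ height x <= t%:Z] =
  (\sum_(b <- fset_set box) 'C(t + #|I| - `|height b|, #|I|))%N.
Proof.
rewrite (@ncard_partition _ _ _ (fun b => translates b t) (fset_set box)).
- apply: eq_big_seq => b; rewrite in_fset_set ?inE; last exact: finite_box.
  by move=> /box_height/ncard_translates.
- apply: sub_finite_set (finite_combinations t) => x [[l [Il xl ls]] hx].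
  have l_ge0 i : 0 <= l 0 i.
    have [iI|iI] := boolP (i \in I); last by rewrite Il.
    by have := ls i iI; case: ifP => // _ /ltW.
  exists l => // i; rewrite l_ge0 /=; move: hx.
  rewrite -(ler_int R) (height_real xl); apply: le_trans.
  by rewrite (bigD1 i) //= lerDl sumr_ge0.
- exact: fset_uniq.
- move=> b x; rewrite in_fset_set ?inE; last exact: finite_box.
  by move=> boxb [[v [Iv v_ge0 ->]] hx]; split=> //; apply: translates_cell.
- move=> x [/cell_translates[b boxb ex] hx]; exists b => //.
  by rewrite in_fset_set ?inE; last exact: finite_box.
- move=> b b' x; rewrite !in_fset_set ?inE; try exact: finite_box.
  move=> boxb boxb' [[v [Iv _ ->]] _] [[v' [Iv' _ e]] _].
  exact: box_translates_uniq e.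
Qed.

End Cell.
End Lattice.

(** * Binomial coefficients as polynomials *)

Section BinomialPolynomial.
Variables (R : numFieldType) (d a : nat).

(* The polynomial [X |-> 'C(X + d - a, d)]. *)
Definition binomial_poly : {poly R} :=
  d`!%:R^-1 *: \prod_(i < d) ('X + (d%:R - a%:R - i%:R)%:P).

Lemma prod_falling (N e : nat) :
  \prod_(i < e) (N%:R - i%:R) = (N ^_ e)%:R :> R.
Proof.
elim: e => [|e IHe]; first by rewrite big_ord0.
rewrite big_ord_recr IHe ffactnSr natrM /=.
have [le_eN|lt_Ne] := leqP e N; first by rewrite natrB.
by rewrite ffact_small // !mul0r.
Qed.

Lemma ffact_bin (N : nat) : d`!%:R^-1 * (N ^_ d)%:R = 'C(N, d)%:R :> R.
Proof.
by rewrite -bin_ffact natrM mulrC mulfK // pnatr_eq0 -lt0n fact_gt0.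
Qed.

(** The bound on [a] keeps the truncated subtraction in [t + d - a] exact. *)
Lemma binomial_polyE (t : nat) : (a <= d)%N ->
  binomial_poly.[t%:R] = 'C(t + d - a, d)%:R.
Proof.
move=> le_ad; rewrite hornerZ horner_prod -ffact_bin -prod_falling.
congr (_ * _); apply: eq_bigr => i _.
by rewrite !hornerE natrB ?natrD // (leq_trans le_ad) ?leq_addl.
Qed.

(** At [- t - 1] the factor of index [d - 1 - i] equals [-(t + a - i)]; reversing the product gives
    a falling factorial up to sign. *)
Lemma binomial_poly_reflect (t : nat) :
  binomial_poly.[- t%:R - 1] = (-1) ^+ d * 'C(t + a, d)%:R.
Proof.
rewrite hornerZ horner_prod -ffact_bin -prod_falling mulrCA; congr (_ * _).
rewrite (reindex_inj rev_ord_inj) /=.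
have -> : (-1) ^+ d = \prod_(i < d) -1 :> R by rewrite prodr_const card_ord.
rewrite -big_split /=; apply: eq_bigr => i _.
by rewrite hornerD hornerX hornerC /= natrB // natrD -natr1; ring.
Qed.

End BinomialPolynomial.

(** * Reciprocity for the lattice points of a cone *)

Section Reciprocity.
Variables (R : realType) (k m : nat) (W : 'M[int]_(k, m)) (h : 'cV[int]_m).
Hypothesis W_height : W *m h = const_mx 1.
Local Notation WR := (map_mx (@intmul R 1) W).
Local Notation lp := (@lattice_point R m).

Section BoxReflection.
Variables (I : {set 'I_k}) (s s' : pred 'I_k).
Hypothesis s_s' : forall i, i \in I -> s' i = ~~ s i.

Let corner : 'rV[int]_m := (\row_i (i \in I)%:R) *m W.

(** Subtraction from the sum of the generators in [I] replaces each coefficient by its complement to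
    1, which exchanges [0,1) and (0,1]. *)
Lemma box_reflect b : box R W I s b -> box R W I s' (corner - b).
Proof.
move=> [l [Il bl ls]]; exists ((\row_i (i \in I)%:R) - l); split.
- by move=> i iI; rewrite !mxE Il // (negPf iI) subr0.
- rewrite /lattice_point map_mxB mulmxBl -bl map_mxM; congr (_ *m _ - _).
  by apply/rowP => i; rewrite !mxE; case: (i \in I).
- move=> i iI; have := ls i iI; rewrite !mxE iI s_s' //.
  by case: (s i) => /= /andP[? ?]; apply/andP; split; lra.
Qed.

Lemma height_corner b : height h (corner - b) = #|I|%:Z - height h b.
Proof.
rewrite [LHS]/height mulmxBl mxE [X in _ + X]mxE -!/(height h _).
congr (_ - _); rewrite -[LHS]/(height h corner) (height_mul W_height).
have -> : #|I|%:Z = \sum_i (i \in I)%:R.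
  rewrite -natz -sum1_card natr_sum big_mkcond /=.
  by apply: eq_bigr => i _; case: (i \in I).
by apply: eq_bigr => i _; rewrite mxE.
Qed.

End BoxReflection.

Lemma sum_box_reflect (I : {set 'I_k}) (s s' : pred 'I_k) (F : int -> nat) :
  (forall i, i \in I -> s' i = ~~ s i) ->
  (\sum_(b <- fset_set (box R W I s')) F (height h b) =
   \sum_(b <- fset_set (box R W I s)) F (#|I|%:Z - height h b)%R)%N.
Proof.
move=> s_s'; pose corner : 'rV[int]_m := (\row_i (i \in I)%:R) *m W.
have invK : involutive (fun b => corner - b) by move=> b; rewrite subKr.
rewrite (perm_big [seq corner - b | b <- fset_set (box R W I s)]) /=.
  by rewrite big_map; apply: eq_bigr => b _; rewrite height_corner.
apply: uniq_perm => [||b].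
- exact: fset_uniq.
- by rewrite (map_inj_uniq (inv_inj invK)) fset_uniq.
rewrite -[b in RHS]invK (mem_map (inv_inj invK)).
rewrite !in_fset_set; try exact: finite_box.
apply/idP/idP; rewrite !inE => bb; last first.
  rewrite -[b]invK; exact: box_reflect bb.
by apply: box_reflect bb => i iI; rewrite s_s' // negbK.
Qed.

Lemma finite_cone_height (C : set 'rV[R]_m) (t : nat) : C `<=` cone WR ->
  finite_set [set x | C (lp x) /\ height h x <= t%:Z].
Proof.
move=> Ccone; apply: sub_finite_set (finite_combinations R W t) => x.
move=> [/Ccone[l l_ge0 xl] hx]; exists l => // i; rewrite l_ge0 /=; move: hx.
rewrite -(ler_int R) (height_real W_height xl); apply: le_trans.
by rewrite (bigD1 i) //= lerDl sumr_ge0.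
Qed.

(** The same optimal bases serve both counts: cells with direction [g] partition the cone, those
    with direction [- g] the open cone. Every basis has [\rank WR] elements, so reflection produces
    one common sign. *)
Theorem cone_reciprocity : exists q : {poly R},
  (forall t : nat,
     q.[t%:R] = (ncard [set x | cone WR (lp x) /\ height h x <= t%:Z])%:R) /\
  (forall t : nat,
     (ncard [set x | open_cone WR (lp x) /\ height h x <= t%:Z])%:R =
     (-1) ^+ \rank WR * q.[- t%:R - 1]).
Proof.
have WRh : WR *m map_mx intr h = const_mx 1.
  by rewrite -map_mxM W_height; apply/matrixP => i j; rewrite !mxE.
have [c c_gen] := exists_generic_cost WR.
have [g g_gt0 g_gen] := exists_generic WR.
pose os := [seq I <- enum {set 'I_k} | `[< optimal WR c I >]].
have os_uniq : uniq os by rewrite filter_uniq // enum_uniq.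
have osP I : (I \in os) <-> optimal WR c I.
  by rewrite mem_filter mem_enum andbT; split=> /asboolP.
have os_ind I : I \in os -> independent WR I by move=> /osP[[]].
pose boxes I := fset_set (box R W I (direction WR g I)).
pose q : {poly R} := \sum_(I <- os) \sum_(b <- boxes I)
  binomial_poly R #|I| `|height h b|%N.
have in_boxes I b : b \in boxes I -> 0 <= height h b <= #|I|%:Z.
  by rewrite in_fset_set ?inE; [apply: box_height | apply: finite_box].
exists q; split=> t.
  rewrite (@ncard_partition _ _ _ (fun I =>
    [set x | cell WR I (direction WR g I) (lp x) /\ height h x <= t%:Z]) os) //.
  - rewrite natr_sum horner_sum; apply: eq_big_seq => I Ios.
    rewrite (ncard_cell W_height); last exact: os_ind.
    rewrite natr_sum horner_sum; apply: eq_big_seq => b /in_boxes hb.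
    by rewrite binomial_polyE //; lia.
  - exact: finite_cone_height.
  - by move=> I x _ [/cell_cone cx hx].
  - move=> x [/(cone_cell WRh c_gen g_gt0 g_gen)[I oI cI] hx].
    by exists I => //; apply/osP.
  - move=> I J x /osP oI /osP oJ [cI _] [cJ _].
    exact: (cell_uniq g_gen oI oJ cI cJ).
rewrite (@ncard_partition _ _ _ (fun I =>
  [set x | cell WR I (direction WR (- g) I) (lp x) /\ height h x <= t%:Z]) os) //.
- rewrite natr_sum horner_sum mulr_sumr; apply: eq_big_seq => I Ios.
  have [bI _] := (osP I).1 Ios.
  rewrite (ncard_cell W_height); last exact: os_ind.
  (* The boxes for [- g] are traded for those for [g]. A height becomes [#|I| - height b], and
     [t + #|I|] minus it is [t + height b], the upper index that evaluation at [- t - 1]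
     produces. *)
  rewrite (sum_box_reflect (s := direction WR g I)
    (fun z => 'C(t + #|I| - `|z|, #|I|))); last first.
    by move=> i iI; apply: directionN.
  rewrite natr_sum horner_sum mulr_sumr; apply: eq_big_seq => b /in_boxes hb.
  rewrite binomial_poly_reflect (card_basis bI) mulrA -exprMn mulrNN mulr1 expr1n.
  by rewrite mul1r -(card_basis bI); congr ('C(_, _)%:R); lia.
- apply: finite_cone_height => _ [l l_gt0 ->].
  by exists l => // i; apply/ltW.
- move=> I x /osP oI [/(cell_open_cone g_gt0 g_gen oI) cx hx]; by [].
- move=> x [/(open_cone_cell WRh c_gen g_gt0 g_gen)[I oI cI] hx].
  by exists I => //; apply/osP.
- move=> I J x /osP oI /osP oJ [cI _] [cJ _].
  exact: (cell_uniq (genericN g_gen) oI oJ cI cJ).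
Qed.

End Reciprocity.

(** * Convex hulls and their relative interiors *)

Section Hulls.
Variables (R : realType) (k m : nat).
Implicit Types (A : 'M[R]_(k, m)) (l : 'rV[R]_k) (x : 'rV[R]_m).

Lemma convex_setP (C : set 'rV[R]_m) : @convex_set R 'rV[R]_m C <->
  forall x y (r : R), 0 <= r <= 1 -> C x -> C y -> C (r *: x + (1 - r) *: y).
Proof.
split=> [cC x y r /andP[r0 r1] Cx Cy|cC x y r].
  by have := cC x y (Itv01 r0 r1); rewrite !inE; apply.
by rewrite !inE => Cx Cy; apply: cC => //; rewrite ge0 le1.
Qed.

Lemma convex_hull_convex (S : set 'rV[R]_m) x y (r : R) : 0 <= r <= 1 ->
  convex_hull S x -> convex_hull S y -> convex_hull S (r *: x + (1 - r) *: y).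
Proof.
move=> r01 Sx Sy C [cC SC]; move/convex_setP: (cC); apply => //.
  exact: Sx.
exact: Sy.
Qed.

Lemma convex_hull_sub (S C : set 'rV[R]_m) :
  (forall x y (r : R), 0 <= r <= 1 -> C x -> C y -> C (r *: x + (1 - r) *: y)) ->
  S `<=` C -> convex_hull S `<=` C.
Proof. by move=> cC SC; apply: smallest_sub => //; apply/convex_setP. Qed.

(** The induction carries unnormalized sums: a partial sum has weight zero or is its weight times a
    point of [C]. *)
Lemma convex_combination (C : set 'rV[R]_m) (T : eqType) (s : seq T)
    (w : T -> R) (v : T -> 'rV[R]_m) :
  (forall x y (r : R), 0 <= r <= 1 -> C x -> C y -> C (r *: x + (1 - r) *: y)) ->
  (forall i, 0 <= w i) -> (forall i, i \in s -> w i != 0 -> C (v i)) ->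
  \sum_(i <- s) w i = 1 -> C (\sum_(i <- s) w i *: v i).
Proof.
move=> cC w_ge0 Cv sum1.
suff [all0|[p Cp ->]] : (\sum_(i <- s) w i = 0) \/
    exists2 p, C p & \sum_(i <- s) w i *: v i = (\sum_(i <- s) w i) *: p.
- by move/eqP: all0; rewrite sum1 oner_eq0.
- by rewrite sum1 scale1r.
have sum_ge0 (r : seq T) : 0 <= \sum_(i <- r) w i by apply: sumr_ge0.
elim: s {sum1} Cv => [|i s IHs] Cv; first by left; rewrite big_nil.
rewrite !big_cons.
have {IHs} := IHs (fun j js => Cv j (mem_behead (s := i :: s) js)).
have [wi0|wi_neq0] := eqVneq (w i) 0.
  by rewrite wi0 scale0r !add0r.
have Cvi : C (v i) by apply: Cv; rewrite ?mem_head.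
case=> [S0|[p Cp eqp]]; right.
  exists (v i) => //; rewrite S0 addr0 big1_seq ?addr0 // => j js.
  move/eqP: S0; rewrite psumr_eq0 // => /allP/(_ j js)/implyP/(_ isT)/eqP ->.
  by rewrite scale0r.
set S := \sum_(j <- s) w j in eqp *; have S_ge0 : 0 <= S := sum_ge0 s.
have wS_gt0 : 0 < w i + S by rewrite ltr_wpDr // lt_def wi_neq0 w_ge0.
exists ((w i / (w i + S)) *: v i + (1 - w i / (w i + S)) *: p).
  apply: cC => //; apply/andP; split; first by rewrite divr_ge0 // ltW.
  by rewrite ler_pdivrMr // mul1r lerDl.
rewrite eqp scalerDr !scalerA mulrBr mulr1 mulrCA divff ?gt_eqF // mulr1.
by rewrite addrAC subrr add0r.
Qed.

Definition hull A : set 'rV[R]_m := [set x | exists l : 'rV[R]_k,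
  [/\ forall i, 0 <= l 0 i, \sum_i l 0 i = 1 & x = l *m A]].

Definition open_hull A : set 'rV[R]_m := [set x | exists l : 'rV[R]_k,
  [/\ forall i, 0 < l 0 i, \sum_i l 0 i = 1 & x = l *m A]].

Lemma hull_convex A x y (r : R) : 0 <= r <= 1 ->
  hull A x -> hull A y -> hull A (r *: x + (1 - r) *: y).
Proof.
move=> /andP[r_ge0 r_le1] [l [l0 l1 ->]] [u [u0 u1 ->]].
exists (r *: l + (1 - r) *: u); split; last by rewrite mulmxDl -!scalemxAl.
  by move=> i; rewrite !mxE addr_ge0 // mulr_ge0 // subr_ge0.
under eq_bigr do rewrite !mxE.
by rewrite big_split /= -!mulr_sumr l1 u1 !mulr1 addrC subrK.
Qed.

Lemma hull_row A i : hull A (row i A).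
Proof.
exists (delta_mx 0 i); split; last by rewrite rowE.
  by move=> j; rewrite mxE ler0n.
rewrite (bigD1 i) //= big1 => [|j /negPf ji]; rewrite mxE ?eqxx ?addr0 //.
by rewrite ji andbF.
Qed.

Lemma hull_min A (C : set 'rV[R]_m) :
  (forall x y (r : R), 0 <= r <= 1 -> C x -> C y -> C (r *: x + (1 - r) *: y)) ->
  (forall i, C (row i A)) -> hull A `<=` C.
Proof.
move=> cC CA _ [l [l0 l1 ->]]; rewrite mulmx_sum_row.
by apply: convex_combination => //.
Qed.

Lemma convex_hull_rows A : convex_hull (range (fun i => row i A)) = hull A.
Proof.
apply/seteqP; split.
  by apply: convex_hull_sub => [|_ [i _ <-]]; [exact: hull_convex | exact: hull_row].
apply: hull_min => [|i]; first exact: convex_hull_convex.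
by apply: sub_gen_smallest; exists i.
Qed.

Lemma affine_hull_line (S : set 'rV[R]_m) x y (r : R) : S x -> S y ->
  affine_hull S (r *: x + (1 - r) *: y).
Proof. by move=> Sx Sy B [aB SB]; apply: aB; apply: SB. Qed.

Lemma affine_hull_hull A x : affine_hull (hull A) x ->
  exists2 l : 'rV[R]_k, \sum_i l 0 i = 1 & x = l *m A.
Proof.
apply: (smallest_sub (X := [set x | exists2 l : 'rV[R]_k,
  \sum_i l 0 i = 1 & x = l *m A])).
  move=> r _ _ [l l1 ->] [u u1 ->].
  exists (r *: l + (1 - r) *: u); last by rewrite mulmxDl -!scalemxAl.
  under eq_bigr do rewrite !mxE.
  by rewrite big_split /= -!mulr_sumr l1 u1 !mulr1 addrC subrK.
by move=> _ [l [_ l1 ->]]; exists l.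
Qed.

(** Pushing [x] slightly away from the barycentre of the rows stays in the hull; [x] is then a
    weighted mean of the new point and the barycentre, so its coefficients are positive. *)
Lemma relint_hull_sub A : (0 < k)%N -> relint (hull A) `<=` open_hull A.
Proof.
move=> k_gt0 x [hx /nbhs_ballP[e e_gt0 near_x]].
pose c : 'rV[R]_k := const_mx k%:R^-1.
have k_neq0 : k%:R != 0 :> R by rewrite pnatr_eq0 -lt0n.
have c_gt0 i : 0 < c 0 i by rewrite mxE invr_gt0 ltr0n.
have c1 : \sum_i c 0 i = 1.
  under eq_bigr do rewrite mxE.
  by rewrite sumr_const card_ord -[_ *+ _]mulr_natr mulVf.
have hc : hull A (c *m A) by exists c; split=> // i; apply/ltW.
have [s s_gt0 small] := @small_perturbation R 'I_m (fun _ => e)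
  (fun j => (x - c *m A) 0 j) (fun _ => e_gt0).
have /near_x : ball x e ((1 + s) *: x + (1 - (1 + s)) *: (c *m A)).
  split=> // i j; rewrite ord1 -ball_normE /= distrC.
  have -> : ((1 + s) *: x + (1 - (1 + s)) *: (c *m A)) 0 j - x 0 j =
      s * (x - c *m A) 0 j by rewrite !mxE; ring.
  by rewrite normrM gtr0_norm // -subr_gt0 small // s_gt0 lexx.
case=> [|l [l0 l1 yl]]; first exact: affine_hull_line.
have s1 : 1 + s != 0 by rewrite gt_eqF // addr_gt0.
exists ((1 + s)^-1 *: (l + s *: c)); split=> [i||].
- have cs : 0 < s * c 0 i by rewrite mulr_gt0.
  have s1_gt0 : 0 < (1 + s)^-1 by rewrite invr_gt0 addr_gt0.
  by rewrite mxE pmulr_rgt0 // mxE ltr_wpDl // mxE.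
- under eq_bigr do rewrite !mxE.
  rewrite -mulr_sumr big_split /= l1 -mulr_sumr.
  have -> : \sum_(i < k) k%:R^-1 = 1 :> R
    by rewrite -[RHS]c1; apply: eq_bigr => i _; rewrite mxE.
  by rewrite mulr1 mulVf.
- rewrite -scalemxAl mulmxDl -yl -scalemxAl -addrA -scalerDl.
  by rewrite opprD addrA subrr add0r addNr scale0r addr0 scalerA mulVf // scale1r.
Qed.

(** A point [y] of the affine hull near [x] is reached by adding to the coefficients a small vector
    of sum zero that depends linearly on [y - x]. *)
Lemma open_hull_sub_relint A : open_hull A `<=` relint (hull A).
Proof.
move=> x [l [l0 l1 xl]]; split.
  by exists l; split=> // i; apply/ltW.
(* The column of ones records the sum of the coefficients. A pseudo-inverse of [B] turns
   [(y - x, 0)] into the correction [v], and [b i] bounds its [i]-th entry per unit of distance. *)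
pose B : 'M[R]_(k, m + 1) := row_mx A (const_mx 1).
pose Bi := lsubmx (pinvmx B)^T.
pose b i := \sum_(j < m) `|pinvmx B (lshift 1 j) i|.
have [s s_gt0 small] := small_perturbation b l0.
apply/nbhs_ballP; exists s => //= y [_ xy] /affine_hull_hull[u u1 yu].
pose d := u - l; pose v := row_mx (y - x) 0 *m pinvmx B.
have dB : d *m B = row_mx (y - x) 0.
  rewrite mul_mx_row mulmxBl -xl -yu; congr row_mx.
  apply/rowP => j; rewrite !mxE; under eq_bigr do rewrite !mxE mulr1.
  by rewrite sumrB u1 l1 subrr.
have vB : v *m B = row_mx (y - x) 0.
  by rewrite /v mulmxKpV // -dB submxMl.
have : v *m B = row_mx (v *m A) (v *m const_mx 1) by rewrite mul_mx_row.
rewrite vB => /esym/eq_row_mx[vA v1].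
exists (l + v); split=> [i||].
- apply/ltW; rewrite mxE; have := small i s; rewrite s_gt0 lexx => /(_ isT).
  move=> /lt_le_trans; apply; rewrite lerD2l lerNl.
  apply: le_trans (ler_norm _) _; rewrite normrN /v mxE big_split_ord /=.
  rewrite [X in _ + X]big1 ?addr0 => [|j _]; last by rewrite row_mxEr mxE mul0r.
  apply: le_trans (ler_norm_sum _ _ _) _.
  rewrite (ger0_norm (sumr_ge0 _ _)) // /b mulr_sumr; apply: ler_sum => j _.
  rewrite row_mxEl normrM ler_wpM2r // !mxE distrC; apply/ltW.
  by have := xy 0 j; rewrite -ball_normE.
- under eq_bigr do rewrite mxE; rewrite big_split /= l1.
  have /matrixP/(_ 0 0) := v1; rewrite !mxE => v1'.
  rewrite -[RHS]addr0 -[in RHS]v1'; congr (_ + _).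
  by apply: eq_bigr => i _; rewrite [X in _ = _ * X]mxE mulr1.
- by rewrite mulmxDl vA -xl addrC subrK.
Qed.

Lemma relint_hull A : (0 < k)%N -> relint (hull A) = open_hull A.
Proof.
move=> k_gt0; apply/seteqP; split; first exact: relint_hull_sub.
exact: open_hull_sub_relint.
Qed.

(** A minimal set of rows that still generates the hull consists of vertices: a row in the convex
    hull of the other points could be rewritten without itself and dropped. *)
Lemma hull_vertices A : (0 < k)%N -> hull A `<=` convex_hull (vertices (hull A)).
Proof.
move=> k_gt0.
pose spans (S : {set 'I_k}) := forall x, hull A x -> exists l : 'rV[R]_k,
  [/\ forall i, 0 <= l 0 i, \sum_i l 0 i = 1, supported S l & x = l *m A].
have spansT : `[< spans [set: 'I_k]%SET >].
  apply/asboolP => x [l [l0 l1 xl]]; exists l; split=> // i.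
  by rewrite finset.in_setT.
have [S /minsetP[/asboolP spS minS] _] :=
  minset_exists (P := fun S => `[< spans S >]) spansT.
suff vertS i : i \in S -> vertices (hull A) (row i A).
  move=> x /spS[l [l0 l1 Sl ->]]; rewrite mulmx_sum_row.
  apply: convex_combination => // [y z r|i _]; first exact: convex_hull_convex.
  have [iS _|/Sl->] := boolP (i \in S); last by rewrite eqxx.
  by apply: sub_gen_smallest; apply: vertS.
move=> iS; split; first exact: hull_row.
(* [Q] is convex and contains every point of the hull except possibly row [i]; if that row is not a
   vertex, it therefore has a representation with coefficient below 1 at [i]. *)
pose Q := [set x : 'rV[R]_m | exists l : 'rV[R]_k,
  [/\ forall i, 0 <= l 0 i, \sum_i l 0 i = 1, supported S l &
      x = l *m A /\ l 0 i < 1]].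
move=> /(@convex_hull_sub _ Q)[].
- move=> _ _ r /andP[r0 r1] [l [l0 l1 Sl [-> li]]] [u [u0 u1 Su [-> ui]]].
  exists (r *: l + (1 - r) *: u); split.
  + by move=> j; rewrite !mxE addr_ge0 // mulr_ge0 // subr_ge0.
  + under eq_bigr do rewrite !mxE.
    by rewrite big_split /= -!mulr_sumr l1 u1 !mulr1 addrC subrK.
  + by move=> j jS; rewrite !mxE Sl // Su // !mulr0 addr0.
  + split; first by rewrite mulmxDl -!scalemxAl.
    rewrite !mxE; have [->|r_neq0] := eqVneq r 0.
      by rewrite mul0r add0r subr0 mul1r.
    have r_gt0 : 0 < r by rewrite lt_def r_neq0.
    have rl : r * l 0 i < r by rewrite gtr_pMr.
    have ru : (1 - r) * u 0 i <= 1 - r by rewrite ler_piMr ?subr_ge0 // ltW.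
    by rewrite -[ltRHS](addrNK r) [ltRHS]addrC ltr_leD.
- move=> x [/spS[l [l0 l1 Sl xl]] /= x_neq]; exists l; split=> //; split=> //.
  have le1 j : l 0 j <= 1 by rewrite -l1 (bigD1 j) //= lerDl sumr_ge0.
  rewrite lt_def le1 andbT; apply/eqP => li1; apply: x_neq.
  suff el : l = delta_mx 0 i by rewrite xl el rowE.
  apply/rowP => j; rewrite mxE /=.
  have [->|ji] := eqVneq j i; first by rewrite -li1.
  move/eqP: l1; rewrite (bigD1 i) //= -li1 -subr_eq0 addrAC subrr add0r.
  by rewrite psumr_eq0 // => /allP/(_ j (mem_index_enum _))/implyP/(_ ji)/eqP.
- move=> l [l0 l1 Sl [il li]].
  have li_neq1 : 1 - l 0 i != 0 by rewrite subr_eq0 gt_eqF.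
  (* Solving for row [i] gives a representation that avoids [i]. *)
  pose l' := (1 - l 0 i)^-1 *: (l - l 0 i *: delta_mx 0 i).
  have l'E j : l' 0 j = if j == i then 0 else (1 - l 0 i)^-1 * l 0 j.
    rewrite !mxE /=; case: eqP => [->|_]; last by rewrite mulr0 subr0.
    by rewrite mulr1 subrr mulr0.
  have l'0 j : 0 <= l' 0 j.
    by rewrite l'E; case: ifP => // _; rewrite mulr_ge0 // invr_ge0 subr_ge0 ltW.
  have l'1 : \sum_j l' 0 j = 1.
    rewrite (bigD1 i) //= l'E eqxx add0r.
    rewrite (eq_bigr (fun j => (1 - l 0 i)^-1 * l 0 j)) => [|j /negPf ji].
      have rest : \sum_(j | j != i) l 0 j = 1 - l 0 i.
        by apply/eqP; rewrite eq_sym subr_eq -l1 (bigD1 i) //= addrC.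
      by rewrite -mulr_sumr rest mulVf.
    by rewrite l'E ji.
  have l'A : row i A = l' *m A.
    rewrite -scalemxAl mulmxBl -il -scalemxAl -rowE -[X in _ *: (X - _)]scale1r.
    by rewrite -scalerBl scalerA mulVf // scale1r.
  have /asboolP/minS/(_ (subsetDl _ _)) : spans (S :\ i)%SET.
    move=> x /spS[u [u0 u1 Su ->]].
    exists (u - u 0 i *: delta_mx 0 i + u 0 i *: l').
    have vE j : (u - u 0 i *: delta_mx 0 i + u 0 i *: l') 0 j =
        if j == i then 0 else u 0 j + u 0 i * l' 0 j.
      by rewrite !mxE /=; case: eqP => [->|_] /=; ring.
    split.
    + move=> j; rewrite vE; case: ifP => // _.
      by rewrite addr_ge0 // mulr_ge0.
    + rewrite (eq_bigr (fun j => u 0 j - u 0 i * (j == i)%:R + u 0 i * l' 0 j))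
        => [|j _]; last by rewrite !mxE.
      rewrite big_split sumrB /= u1 -!mulr_sumr l'1 mulr1 (bigD1 i) //= eqxx.
      by rewrite big1 ?addr0 ?mulr1 ?subrK // => j /negPf ->.
    + move=> j; rewrite vE !finset.inE negb_and negbK; case: eqP => //= _ jS.
      by rewrite l'E (Su j jS) (Sl j jS) add0r; case: ifP; rewrite !mulr0.
    + by rewrite mulmxDl mulmxBl -(scalemxAl _ l') -l'A -scalemxAl -rowE subrK.
  by move=> /finset.setP/(_ i); rewrite iS !finset.inE eqxx.
Qed.

End Hulls.

(** * Dilations and cancellation of Minkowski summands *)

Section Dilations.
Variables (R : realType) (k m : nat).
Implicit Types (A : 'M[R]_(k, m)) (z : R) (a : 'rV[R]_m) (t : nat).

(** The slice at height [z] of the cone over the vectors [(row i A, 1)]. *)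
Definition weighted_hull A z : set 'rV[R]_m := [set x | exists l : 'rV[R]_k,
  [/\ forall i, 0 <= l 0 i, \sum_i l 0 i = z & x = l *m A]].

Definition open_weighted_hull A z : set 'rV[R]_m := [set x | exists l : 'rV[R]_k,
  [/\ forall i, 0 < l 0 i, \sum_i l 0 i = z & x = l *m A]].

Lemma weighted_hull0 A x : weighted_hull A 0 x -> x = 0.
Proof.
move=> [l [l0 /eqP l1 ->]]; rewrite (_ : l = 0) ?mul0mx //.
apply/rowP => i; rewrite mxE; move: l1; rewrite psumr_eq0 //.
by move=> /allP/(_ i (mem_index_enum _))/eqP.
Qed.

Lemma sum_scale (z : R) (l : 'rV[R]_k) :
  \sum_i (z *: l) 0 i = z * \sum_i l 0 i.
Proof. by rewrite mulr_sumr; apply: eq_bigr => i _; rewrite mxE. Qed.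

Lemma dilate_hull A t : (0 < k)%N ->
  dilate t (hull A) = weighted_hull A t%:R.
Proof.
move=> k_gt0; apply/seteqP; split=> [_ [_ [l [l0 l1 ->]] <-]|x wx].
  exists (t%:R *: l); split; last by rewrite scalemxAl.
    by move=> i; rewrite mxE mulr_ge0.
  by rewrite sum_scale l1 mulr1.
have [t0|t_neq0] := eqVneq t 0%N.
  move: wx; rewrite t0 => /weighted_hull0 ->.
  exists (row (Ordinal k_gt0) A); [exact: hull_row | exact: scale0r].
have t_neq0' : t%:R != 0 :> R by rewrite pnatr_eq0.
have [l [l0 l1 ->]] := wx.
exists (t%:R^-1 *: l *m A); last by rewrite -scalemxAl scalerA divff // scale1r.
exists (t%:R^-1 *: l); split=> //; first by move=> i; rewrite mxE mulr_ge0.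
by rewrite sum_scale l1 mulVf.
Qed.

Lemma dilate_open_hull A t : (0 < t)%N ->
  dilate t (open_hull A) = open_weighted_hull A t%:R.
Proof.
move=> t_gt0; have t_gt0' : 0 < t%:R :> R by rewrite ltr0n.
apply/seteqP; split=> [_ [_ [l [l0 l1 ->]] <-]|x [l [l0 l1 ->]]].
  exists (t%:R *: l); split; last by rewrite scalemxAl.
    by move=> i; rewrite mxE mulr_gt0.
  by rewrite sum_scale l1 mulr1.
exists (t%:R^-1 *: l *m A); last first.
  by rewrite -scalemxAl scalerA divff ?gt_eqF // scale1r.
exists (t%:R^-1 *: l); split=> //.
  by move=> i; rewrite mxE mulr_gt0 ?invr_gt0.
by rewrite sum_scale l1 mulVf // gt_eqF.
Qed.

(* The absolute value of a left eigenvector of a nonnegative matrix with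
   constant row sums is again an eigenvector. *)
Lemma stationary_vector (C : 'M[R]_k) z : (0 < k)%N ->
  (forall i j, 0 <= C i j) -> (forall i, \sum_j C i j = z) ->
  exists l : 'rV[R]_k,
    [/\ forall i, 0 <= l 0 i, \sum_i l 0 i = 1 & l *m C = z *: l].
Proof.
move=> k_gt0 C_ge0 C_sum.
have z_ge0 : 0 <= z by rewrite -(C_sum (Ordinal k_gt0)) sumr_ge0.
have : \det (C - z%:M) == 0.
  rewrite -det_tr; apply/det0P; exists (const_mx 1).
    by apply/eqP => /rowP/(_ (Ordinal k_gt0))/eqP; rewrite !mxE oner_eq0.
  apply/rowP => i; rewrite !mxE; under eq_bigr do rewrite !mxE mul1r.
  rewrite sumrB C_sum (bigD1 i) //= eqxx big1 => [|j /negPf ji].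
    by rewrite addr0 subrr.
  by rewrite eq_sym ji.
move=> /det0P[v v_neq0]; rewrite mulmxBr mul_mx_scalar => /eqP.
rewrite subr_eq0 => /eqP vC; pose s := \sum_i `|v 0 i|.
have s_gt0 : 0 < s.
  rewrite lt_def sumr_ge0 // andbT; apply: contra v_neq0.
  rewrite psumr_eq0 // => /allP all0; apply/eqP/rowP => i; rewrite mxE.
  by apply/eqP; rewrite -normr_eq0; apply: (all0 i (mem_index_enum _)).
have le_vC j : z * `|v 0 j| <= \sum_i `|v 0 i| * C i j.
  have /rowP/(_ j) := vC; rewrite !mxE => vCj.
  rewrite -(ger0_norm z_ge0) -normrM -vCj.
  apply: le_trans (ler_norm_sum _ _ _) _; apply: ler_sum => i _.
  by rewrite normrM (ger0_norm (C_ge0 i j)).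
(* The inequalities [le_vC] are equalities because both sides have the same sum over [j], the rows
   of [C] summing to [z]. *)
have eq_vC j : \sum_i `|v 0 i| * C i j = z * `|v 0 j|.
  apply/eqP; rewrite -subr_eq0.
  have : \sum_j (\sum_i `|v 0 i| * C i j - z * `|v 0 j|) == 0.
    rewrite sumrB exchange_big /= -mulr_sumr subr_eq0 mulr_sumr.
    by apply/eqP/eq_bigr => i _; rewrite -mulr_sumr C_sum mulrC.
  rewrite psumr_eq0 => [/allP/(_ j (mem_index_enum _))//|j' _].
  by rewrite subr_ge0.
exists (s^-1 *: \row_i `|v 0 i|); split=> [i||].
- by rewrite !mxE mulr_ge0 // invr_ge0 ltW.
- rewrite sum_scale (eq_bigr (fun i => `|v 0 i|)) => [|i _]; last by rewrite mxE.
  by rewrite mulVf // gt_eqF.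
- rewrite -scalemxAl scalerA mulrC -scalerA; congr (_ *: _).
  apply/rowP => j; rewrite !mxE -eq_vC.
  by apply: eq_bigr => i _; rewrite mxE.
Qed.

Section Cancellation.
Variables (A : 'M[R]_(k, m)) (z w : R) (a : 'rV[R]_m).
Hypotheses (k_gt0 : (0 < k)%N)
  (A_nonconst : exists j, exists i i', A i j != A i' j).

Lemma extremal_rows : exists j i i', A i' j < A i j /\
  forall i0, A i' j <= A i0 j <= A i j.
Proof.
have [j [p [q pq]]] := A_nonconst.
case: (@arg_maxP _ _ _ (Ordinal k_gt0) xpredT (fun i => A i j)) => // i _ maxi.
case: (@arg_minP _ _ _ (Ordinal k_gt0) xpredT (fun i => A i j)) => // i' _ mini.
have le_max i0 : A i0 j <= A i j by exact: maxi.
have ge_min i0 : A i' j <= A i0 j by exact: mini.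
exists j, i, i'; split=> [|i0]; last by rewrite le_max ge_min.
rewrite lt_neqAle ge_min andbT; apply: contra pq => /eqP e.
apply/eqP; have := le_max p; have := le_max q; have := ge_min p.
by have := ge_min q; lra.
Qed.

Let entry (l : 'rV[R]_k) i j : z *: row i A + a = l *m A ->
  z * A i j + a 0 j = \sum_i' l 0 i' * A i' j.
Proof. by move=> /rowP/(_ j); rewrite !mxE. Qed.

(** Averaging the relations with weights [l] gives [w *: l *m A = z *: l *m A + a]. *)
Lemma stationary_eq (l : 'rV[R]_k) (C : 'M[R]_k) :
  \sum_i l 0 i = 1 -> l *m C = w *: l ->
  (forall i, z *: row i A + a = row i C *m A) -> a = (w - z) *: l *m A.
Proof.
move=> l1 lC CA; have : C *m A = z *: A + const_mx 1 *m a.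
  apply/row_matrixP => i; rewrite row_mul -CA linearD linearZ /= row_mul.
  by congr (_ + _); apply/rowP => j; rewrite !mxE big_ord1 !mxE mul1r.
move/(congr1 (mulmx l)); rewrite mulmxA lC mulmxDr -scalemxAr mulmxA.
have -> : l *m const_mx 1 = 1%:M :> 'M[R]_(1, 1).
  apply/matrixP => i j; rewrite !ord1 !mxE -[RHS]l1.
  by apply: eq_bigr => i' _; rewrite mxE mulr1.
by rewrite mul1mx scalerBl mulmxBl -!scalemxAl => ->; rewrite addrAC subrr add0r.
Qed.

(** Comparing extents in a nonconstant column gives [z <= w]. The coefficients of the given points
    form a nonnegative matrix with row sums [w], whose stationary vector represents [a]. *)
Lemma cancel_weighted_hull :
  (forall i, weighted_hull A w (z *: row i A + a)) ->
  z <= w /\ weighted_hull A (w - z) a.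
Proof.
move=> /choice[f fP]; have le_zw : z <= w.
  have [j [i [i' [lt_ii' ext]]]] := extremal_rows.
  have [l0 l1 /(entry j) li] := fP i; have [l'0 l'1 /(entry j) li'] := fP i'.
  have hi : z * A i j + a 0 j <= w * A i j.
    rewrite li -l1 mulr_suml; apply: ler_sum => i0 _.
    by rewrite ler_wpM2l //; have /andP[] := ext i0.
  have lo : w * A i' j <= z * A i' j + a 0 j.
    rewrite li' -l'1 mulr_suml; apply: ler_sum => i0 _.
    by rewrite ler_wpM2l //; have /andP[] := ext i0.
  rewrite -(ler_pM2r (_ : 0 < A i j - A i' j)) ?subr_gt0 // !mulrBr; lra.
split=> //; pose C := \matrix_i f i.
have [i j|i|l [l0 l1 lC]] := @stationary_vector C w k_gt0.
- by rewrite mxE; case: (fP i).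
- by case: (fP i) => _ <- _; apply: eq_bigr => j _; rewrite mxE.
exists ((w - z) *: l); split=> [i||].
- by rewrite mxE mulr_ge0 // subr_ge0.
- by rewrite sum_scale l1 mulr1.
- by apply: (stationary_eq l1 lC) => i; rewrite rowK; case: (fP i).
Qed.

Lemma cancel_open_weighted_hull : 0 < w ->
  (forall i, open_weighted_hull A w (z *: row i A + a)) ->
  z < w /\ open_weighted_hull A (w - z) a.
Proof.
move=> w_gt0 /choice[f fP]; have lt_zw : z < w.
  have [j [i [i' [lt_ii' ext]]]] := extremal_rows.
  have [l0 l1 /(entry j) li] := fP i; have [l'0 l'1 /(entry j) li'] := fP i'.
  have hi : z * A i j + a 0 j < w * A i j.
    rewrite li -l1 mulr_suml [ltLHS](bigD1 i') //= [ltRHS](bigD1 i') //=.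
    rewrite ltr_leD ?ltr_pM2l //; apply: ler_sum => i0 _.
    by apply: ler_wpM2l; [exact/ltW | have /andP[] := ext i0].
  have lo : w * A i' j <= z * A i' j + a 0 j.
    rewrite li' -l'1 mulr_suml; apply: ler_sum => i0 _.
    by apply: ler_wpM2l; [exact/ltW | have /andP[] := ext i0].
  rewrite -(ltr_pM2r (_ : 0 < A i j - A i' j)) ?subr_gt0 // !mulrBr; lra.
split=> //; pose C := \matrix_i f i.
have C_gt0 i j : 0 < C i j by rewrite mxE; case: (fP i).
have [i j|i|l [l0 l1 lC]] := @stationary_vector C w k_gt0; first exact: ltW.
  by case: (fP i) => _ <- _; apply: eq_bigr => j _; rewrite mxE.
(* [C] is positive and [l] is nonnegative and nonzero, so [w *: l = l *m C] is positive. *)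
have l_gt0 j : 0 < l 0 j.
  rewrite -(pmulr_rgt0 _ w_gt0).
  have -> : w * l 0 j = (l *m C) 0 j by rewrite lC mxE.
  have [i li] : exists i, 0 < l 0 i.
    apply: contrapT => /forallNP no; have := oner_neq0 R.
    rewrite -l1 big1 ?eqxx // => i _.
    by apply/eqP; rewrite eq_le l0 andbT leNgt; apply/negP.
  rewrite mxE (bigD1 i) //= ltr_pwDl ?mulr_gt0 // sumr_ge0 // => i' _.
  by rewrite mulr_ge0 // ltW.
exists ((w - z) *: l); split=> [i||].
- by rewrite mxE mulr_gt0 // subr_gt0.
- by rewrite sum_scale l1 mulr1.
- by apply: (stationary_eq l1 lC) => i; rewrite rowK; case: (fP i).
Qed.

End Cancellation.
End Dilations.

(** * Gigantures and the pyramid *)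

Section LatticePolytope.
Variables (R : realType) (k n : nat) (V : 'M[int]_(k, n)).
Hypothesis k_gt0 : (0 < k)%N.
Local Notation VR := (map_mx (@intmul R 1) V).
Local Notation P := (hull VR).
Local Notation W := (row_mx V (const_mx 1 : 'M[int]_(k, 1))).
Local Notation WR := (map_mx (@intmul R 1) W).
Local Notation lp := (@lattice_point R _).

Let last : 'cV[int]_(n + 1) := col_mx 0 (const_mx 1).
Local Notation ht := (height last).

Lemma homogenization_height : W *m last = const_mx 1.
Proof.
rewrite mul_row_col mulmx0 add0r; apply/matrixP => i j.
by rewrite !mxE big_ord1 !mxE mulr1.
Qed.

Lemma height_row (a : 'rV[int]_n) (z : int) : ht (row_mx a (const_mx z)) = z.
Proof. by rewrite /height mul_row_col mulmx0 add0r !mxE big_ord1 !mxE mulr1. Qed.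

Lemma row_height (x : 'rV[int]_(n + 1)) :
  x = row_mx (lsubmx x) (const_mx (ht x)).
Proof.
have [a [b ->]] : exists a b, x = row_mx a b.
  by exists (lsubmx x), (rsubmx x); rewrite hsubmxK.
have -> : b = const_mx (b 0 0) by apply/rowP => i; rewrite mxE !ord1.
by rewrite row_mxKl height_row.
Qed.

Lemma homogenization_mul (y : 'rV[R]_n) (z : R) (l : 'rV[R]_k) :
  row_mx y (const_mx z) = l *m WR <-> \sum_i l 0 i = z /\ y = l *m VR.
Proof.
rewrite map_row_mx mul_mx_row map_const_mx.
have -> : l *m const_mx 1%:~R = const_mx (\sum_i l 0 i) :> 'rV[R]_1.
  apply/rowP => i; rewrite !mxE; apply: eq_bigr => j _.
  by rewrite mxE mulr1.
split=> [/eq_row_mx[-> /matrixP/(_ 0 0)]|[-> ->]//].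
by rewrite !mxE => ->.
Qed.

Lemma cone_homogenization (y : 'rV[R]_n) (z : R) :
  cone WR (row_mx y (const_mx z)) <-> weighted_hull VR z y.
Proof.
split=> [[l l0 /homogenization_mul[l1 ly]]|[l [l0 l1 ly]]]; exists l => //.
by apply/homogenization_mul.
Qed.

Lemma open_cone_homogenization (y : 'rV[R]_n) (z : R) :
  open_cone WR (row_mx y (const_mx z)) <-> open_weighted_hull VR z y.
Proof.
split=> [[l l0 /homogenization_mul[l1 ly]]|[l [l0 l1 ly]]]; exists l => //.
by apply/homogenization_mul.
Qed.

Lemma lattice_point_row (a : 'rV[int]_n) (z : int) :
  lp (row_mx a (const_mx z : 'rV_1)) = row_mx (lp a) (const_mx z%:~R).
Proof. by rewrite /lattice_point map_row_mx map_const_mx. Qed.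

(** * Gigantures as lattice points of the cone *)

Section Gigantures.
Hypothesis V_nonconst : exists j, exists i i', VR i j != VR i' j.

Lemma giganture_sub_dilate i t (a : 'rV[int]_n) :
  [set i%:R *: x + lp a | x in P] `<=` dilate t P <->
  (i <= t)%N /\ weighted_hull VR (t%:R - i%:R) (lp a).
Proof.
rewrite dilate_hull //; split=> [sub|[le_it [u [u0 u1 ua]]]].
  have [j|] := @cancel_weighted_hull _ _ _ VR i%:R t%:R (lp a) k_gt0 V_nonconst.
    by apply: sub; exists (row j VR) => //; exact: hull_row.
  by rewrite ler_nat.
move=> _ [_ [l [l0 l1 ->]] <-]; exists (i%:R *: l + u); split.
- by move=> j; rewrite !mxE addr_ge0 // mulr_ge0.
- under eq_bigr do rewrite !mxE.
  by rewrite big_split /= -mulr_sumr l1 u1 mulr1 addrC subrK.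
- by rewrite mulmxDl -scalemxAl ua.
Qed.

Lemma giganture_sub_dilate_relint i t (a : 'rV[int]_n) : (0 < t)%N ->
  [set i%:R *: x + lp a | x in P] `<=` dilate t (relint P) <->
  (i <= t)%N /\ open_weighted_hull VR (t%:R - i%:R) (lp a).
Proof.
move=> t_gt0; rewrite relint_hull // dilate_open_hull //.
split=> [sub|[le_it [u [u0 u1 ua]]]].
  have [|j|] :=
    @cancel_open_weighted_hull _ _ _ VR i%:R t%:R (lp a) k_gt0 V_nonconst.
  - by rewrite ltr0n.
  - by apply: sub; exists (row j VR) => //; exact: hull_row.
  - by rewrite ltr_nat => /ltnW.
move=> _ [_ [l [l0 l1 ->]] <-]; exists (i%:R *: l + u); split.
- by move=> j; rewrite !mxE ltr_wpDl // mulr_ge0.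
- under eq_bigr do rewrite !mxE.
  by rewrite big_split /= -mulr_sumr l1 u1 mulr1 addrC subrK.
- by rewrite mulmxDl -scalemxAl ua.
Qed.

(** Mutual inclusion gives, after cancellation, [i = i'] and [a - a'] in the slice of weight 0,
    which contains only 0. *)
Lemma giganture_inj i i' (a a' : 'rV[int]_n) :
  [set i%:R *: x + lp a | x in P] = [set i'%:R *: x + lp a' | x in P] ->
  i = i' /\ a = a'.
Proof.
have le j j' (b b' : 'rV[int]_n) :
    [set j%:R *: x + lp b | x in P] `<=` [set j'%:R *: x + lp b' | x in P] ->
    (j <= j')%N /\ weighted_hull VR (j'%:R - j%:R) (lp (b - b')).
  move=> sub; apply/giganture_sub_dilate => _ [x Px <-].
  have [y Py eqy] := sub _ (ex_intro2 _ _ x Px erefl); exists y => //.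
  by rewrite /lattice_point map_mxB addrA -eqy addrK.
move=> e; have [|le1 w1] := le i i' a a'; first by rewrite e.
have [|le2 _] := le i' i a' a; first by rewrite e.
have eq_i : i = i' by apply/eqP; rewrite eqn_leq le1.
split=> //; move: w1; rewrite eq_i subrr => /weighted_hull0 e0.
apply/eqP; rewrite -subr_eq0; apply/eqP; apply: (@lattice_point_inj R).
by rewrite e0; apply/rowP => j; rewrite !mxE.
Qed.

(** The giganture [iP + a] corresponds to the lattice point [(a, t - i)]. [K] stands for the cone or
    the open cone; heights in it are nonnegative, so every lattice point of height at most [t] comes
    from some [i <= t]. *)
Lemma giganture_countE (K : set 'rV[R]_(n + 1)) X t : K `<=` cone WR ->
  (forall i (a : 'rV[int]_n), [set i%:R *: x + lp a | x in P] `<=` X <->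
     (i <= t)%N /\ K (row_mx (lp a) (const_mx (t%:R - i%:R)))) ->
  giganture_count P X = ncard [set x | K (lp x) /\ ht x <= t%:Z].
Proof.
move=> Kcone subX.
have ht_ge0 x : K (lp x) -> 0 <= ht x.
  move=> /Kcone[l l0 xl]; rewrite -(ler_int R).
  by rewrite (height_real homogenization_height xl) sumr_ge0.
symmetry; apply: (@ncard_bij _ _ _ _ (fun x : 'rV[int]_(n + 1) =>
  [set (absz (t%:Z - ht x))%:R *: p + lp (lsubmx x) | p in P])).
- exact: (finite_cone_height homogenization_height).
- move=> x [Kx hx]; split; first by exists (absz (t%:Z - ht x)), (lsubmx x).
  have := ht_ge0 x Kx => hx0; apply/subX; split; first by lia.
  move: Kx; rewrite {1}[x]row_height lattice_point_row.
  have -> : t%:R - (absz (t%:Z - ht x))%:R = (ht x)%:~R :> R; last by [].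
  rewrite -[X in X - _]/(t%:Z%:~R) -[X in _ - X]/((absz (t%:Z - ht x))%:Z%:~R).
  by rewrite -intrB; congr (_%:~R); lia.
- move=> x y [Kx hx] [Ky hy] /giganture_inj[eh ea].
  rewrite [x]row_height [y]row_height ea; congr (row_mx _ (const_mx _)).
  by have := ht_ge0 x Kx; have := ht_ge0 y Ky; lia.
- move=> _ [[i [a ->]] /subX[le_it Ka]].
  exists (row_mx a (const_mx (t%:Z - i%:Z))).
    split; first by rewrite lattice_point_row intrB.
    by rewrite height_row; lia.
  have -> : absz (t%:Z - ht (row_mx a (const_mx (t%:Z - i%:Z)%R)))%R = i.
    by rewrite height_row; lia.
  by rewrite row_mxKl.
Qed.

Lemma Hcount_hull t :
  Hcount P t = ncard [set x | cone WR (lp x) /\ ht x <= t%:Z].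
Proof.
apply: giganture_countE => // i a.
by rewrite giganture_sub_dilate cone_homogenization.
Qed.

Lemma Hcount_int_hull t : (0 < t)%N ->
  Hcount_int P t = ncard [set x | open_cone WR (lp x) /\ ht x <= t%:Z].
Proof.
move=> t_gt0; apply: giganture_countE => [_ [l l0 ->]|i a].
  by exists l => // i; apply/ltW.
by rewrite giganture_sub_dilate_relint // open_cone_homogenization.
Qed.

End Gigantures.

(** * The pyramid and the rank of the homogenization *)

Let pyrR : 'M[R]_(k + 1, n + 1) :=
  col_mx (row_mx VR 0) (row_mx 0 (const_mx 1)).

(** [pyrR] has every row of [V] in its base, not only vertices; the extra rows already lie in the
    hull of the vertices. *)
Lemma pyramid_hull : pyramid P = hull pyrR.
Proof.
apply/seteqP; split.
  apply: convex_hull_sub => [|_ [[v [[l [l0 l1 vl]] _] <-]|->]].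
  - exact: hull_convex.
  - exists (row_mx l 0); split.
    + move=> i; case: (split_ordP i) => j ->; rewrite ?row_mxEl ?row_mxEr //.
      by rewrite mxE.
    + rewrite big_split_ord /= [X in _ + X]big1 => [|i _].
        by rewrite addr0 -l1; apply: eq_bigr => i _; rewrite row_mxEl.
      by rewrite row_mxEr mxE.
    + by rewrite mul_row_col mul_mx_row mulmx0 mul0mx addr0 -vl.
  - have := hull_row pyrR (rshift k 0).
    rewrite rowKd (_ : row 0 _ = row_mx 0 1) //.
    by rewrite row_row_mx; congr row_mx; apply/rowP => i; rewrite !mxE ?ord1.
apply: hull_min => [|i]; first exact: convex_hull_convex.
case: (split_ordP i) => j ->; rewrite ?rowKu ?rowKd row_row_mx.
  rewrite (_ : row j 0 = 0); last by apply/rowP => i'; rewrite !mxE.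
  have := hull_vertices k_gt0 (hull_row VR j).
  apply: (@convex_hull_sub _ _ _
    [set v | pyramid P (row_mx v 0)]) => [x y r r01 Px Py|v vP] /=.
    have := convex_hull_convex r01 Px Py.
    by rewrite !scale_row_mx add_row_mx !scaler0 addr0.
  by apply: sub_gen_smallest; left; exists v.
apply: sub_gen_smallest; right; congr row_mx.
  by apply/rowP => i'; rewrite !mxE.
by apply/rowP => i'; rewrite !mxE ord1.
Qed.

Lemma pyramid_mul (y : 'rV[R]_n) (z : R) (l : 'rV[R]_k) (l' : R) :
  row_mx y (const_mx z) = row_mx l (const_mx l') *m pyrR <->
  y = l *m VR /\ z = l'.
Proof.
rewrite mul_row_col !mul_mx_row !mulmx0 add_row_mx addr0 add0r.
have -> : (const_mx l' : 'M[R]_(1, 1)) *m (const_mx 1 : 'M[R]_(1, 1)) =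
    const_mx l'.
  by apply/rowP => i; rewrite !mxE big_ord1 !mxE mulr1.
split=> [/eq_row_mx[-> /matrixP/(_ 0 0)]|[-> ->]//].
by rewrite !mxE => ->.
Qed.

(** The map [(a, s) -> (a, t + 1 - s)] exchanges the height in the cone with the coefficient of the
    apex. That coefficient is a positive integer, which turns [t + 1] into the bound [t] on the
    height. *)
Lemma ehrhart_relint_pyramid t :
  ehrhart (relint (pyramid P)) t.+1 =
  ncard [set x | open_cone WR (lp x) /\ ht x <= t%:Z].
Proof.
rewrite pyramid_hull relint_hull ?addn1 // /ehrhart dilate_open_hull //.
have sumE (l : 'rV[R]_k) (l' : R) :
    \sum_i (row_mx l (const_mx l') : 'rV_(k + 1)) 0 i = \sum_i l 0 i + l'.
  rewrite big_split_ord /= big_ord1 row_mxEr mxE; congr (_ + _).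
  by apply: eq_bigr => i _; rewrite row_mxEl.
symmetry; apply: (@ncard_bij _ _ _ _ (fun x : 'rV[int]_(n + 1) =>
  row_mx (lsubmx x) (const_mx (t.+1%:Z - ht x)))).
- apply: (finite_cone_height homogenization_height) => _ [l l0 ->].
  by exists l => // i; apply/ltW.
- move=> x [Kx hx] /=; rewrite lattice_point_row.
  move: Kx; rewrite {1}[x]row_height lattice_point_row.
  move=> /open_cone_homogenization[l [l0 l1 xl]].
  exists (row_mx l (const_mx (t.+1%:Z - ht x)%:~R)); split.
  + move=> i; case: (split_ordP i) => j ->; rewrite ?row_mxEl ?row_mxEr //.
    by rewrite mxE ltr0z; lia.
  + by rewrite sumE l1 -intrD addrC subrK.
  + by apply/pyramid_mul.
- move=> x y _ _ /eq_row_mx[ea /matrixP/(_ 0 0)]; rewrite !mxE => eh.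
  by rewrite [x]row_height [y]row_height ea; congr (row_mx _ (const_mx _)); lia.
- move=> y [l [l0 l1]].
  pose u : 'rV[R]_k := lsubmx l; pose u' := l 0 (rshift k 0).
  have lE : l = row_mx u (const_mx u').
    rewrite -[LHS]hsubmxK; congr row_mx; apply/rowP => i.
    by rewrite !mxE ord1.
  move: l1; rewrite lE sumE => u1.
  rewrite [y]row_height lattice_point_row => /pyramid_mul[yu hu].
  exists (row_mx (lsubmx y) (const_mx (t.+1%:Z - ht y))).
    split.
      rewrite lattice_point_row; apply/open_cone_homogenization.
      exists u; split=> //; first by move=> i; rewrite mxE.
      by rewrite intrB hu -[_%:~R]u1 addrK.
    rewrite height_row; suff : 0 < ht y by lia.
    by rewrite -(ltr_int R) hu; apply: l0.
  by rewrite height_row row_mxKl subKr -row_height.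
Qed.

(** The rows of [WR] span the same space as the affine hull of [P] placed at height 1, and so do the
    rows of [U]: the [d] directions in [B] and one base point, which are independent. *)
Lemma rank_homogenization d : has_dim P d -> \rank WR = d.+1.
Proof.
move=> [x0 [B freeB affP]].
have affE x : affine_hull P x <-> exists u : 'rV_d, x = x0 + u *m B.
  by rewrite affP; split=> [[u _ <-]|[u ->]]; exists u.
pose U : 'M[R]_(d + 1, n + 1) := col_mx (row_mx B 0) (row_mx x0 (const_mx 1)).
have aff_W x : affine_hull P x -> (row_mx x (const_mx 1) <= WR)%MS.
  move=> /affine_hull_hull[l l1 xl]; apply/submxP; exists l.
  exact/homogenization_mul.
have -> : \rank WR = \rank U.
  apply/eqP; rewrite eqn_leq; apply/andP; split; apply: mxrankS.
    apply/row_subP => i.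
    have [u iu] : exists u : 'rV_d, row i VR = x0 + u *m B.
      by apply/affE; apply: sub_gen_smallest; exact: hull_row.
    apply/submxP; exists (row_mx u (const_mx 1)).
    rewrite map_row_mx row_row_mx iu map_const_mx row_const mul_row_col.
    rewrite !mul_mx_row mulmx0 add_row_mx add0r addrC; congr row_mx.
      congr (_ + _); apply/rowP => j.
      by rewrite !mxE big_ord1 !mxE mul1r.
    by apply/rowP => j; rewrite !mxE big_ord1 !mxE mulr1.
  have x0W : (row_mx x0 (const_mx 1) <= WR)%MS.
    by apply/aff_W/affE; exists 0; rewrite mul0mx addr0.
  rewrite col_mx_sub x0W andbT; apply/row_subP => i.
  have : (row_mx (x0 + row i B) (const_mx 1) <= WR)%MS.
    by apply/aff_W/affE; exists (delta_mx 0 i); rewrite rowE.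
  move=> /addmx_sub/(_ (scalemx_sub (-1) x0W)).
  rewrite scale_row_mx add_row_mx !scaleN1r addrAC subrr add0r subrr row_row_mx.
  by congr (row_mx _ _ <= _)%MS; apply/rowP => j; rewrite !mxE.
rewrite -[RHS]addn1; apply/eqP; apply: inj_row_free => v.
rewrite -[v]hsubmxK mul_row_col !mul_mx_row mulmx0 add_row_mx add0r.
rewrite -[0 in RHS]row_mx0 => /eq_row_mx[e1 e2].
have v2 : rsubmx v = 0.
  apply/rowP => i; have /rowP/(_ i) := e2.
  by rewrite [LHS]mxE big_ord1 [X in _ * X]mxE mulr1 (ord1 i).
move: e1; rewrite v2 mul0mx addr0 => /eqP; rewrite mulmx_free_eq0 // => /eqP ->.
by rewrite row_mx0.
Qed.

(** If all columns of [V] were constant, [WR] would be a column of ones times a single row. *)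
Lemma nonconst_rows : (1 < \rank WR)%N ->
  exists j, exists i i', VR i j != VR i' j.
Proof.
move=> rk; apply: contrapT => no.
suff : (\rank WR <= 1)%N by rewrite leqNgt rk.
have -> : WR = const_mx 1 *m row (Ordinal k_gt0) WR.
  apply/row_matrixP => i; rewrite row_mul.
  have -> : row i (const_mx 1 : 'cV[R]_k) = 1%:M.
    by apply/matrixP => a b; rewrite !ord1 !mxE.
  rewrite mul1mx !map_row_mx !row_row_mx !map_const_mx !row_const.
  congr row_mx; apply/rowP => j; rewrite ![row _ _ _ _]mxE.
  by apply: contrapT => e; apply: no; exists j, i, (Ordinal k_gt0); apply/eqP.
exact: leq_trans (mxrankM_maxr _ _) (rank_leq_row _).
Qed.

End LatticePolytope.

Lemma lattice_polytope_hull (R : realType) n (P : set 'rV[R]_n) :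
  lattice_polytope P ->
  exists k (V : 'M[int]_(k, n)), (0 < k)%N /\ P = hull (map_mx intr V).
Proof.
move=> [A [/finite_seqP[s ->] [a /= a_s]] ->].
exists (size s), (\matrix_i nth 0 s i); split; first by case: s a_s.
rewrite -convex_hull_rows; congr convex_hull; apply/seteqP; split.
  move=> _ [x /= xs <-].
  have lt_s : (index x s < size s)%N by rewrite index_mem.
  exists (Ordinal lt_s) => //; rewrite -map_row rowK /=.
  by rewrite nth_index.
move=> _ [i _ <-]; rewrite -map_row rowK; exists (nth 0 s i) => //=.
exact: mem_nth.
Qed.

(** A nonzero difference would have too many roots. This identifies the polynomial chosen in [Hpoly]
    with the explicit one. *)
Lemma poly_eq_nat (R : numDomainType) (p q : {poly R}) :
  (forall t : nat, p.[t%:R] = q.[t%:R]) -> p = q.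
Proof.
move=> pq; apply/eqP; rewrite -subr_eq0; apply: contraT => pq_neq0.
pose s : seq R := [seq i%:R | i <- iota 0 (size (p - q))].
have /(max_poly_roots pq_neq0) : all (root (p - q)) s.
  by apply/allP => _ /mapP[i _ ->]; rewrite /root !hornerE pq subrr.
rewrite map_inj_uniq ?iota_uniq; last first.
  by move=> i j /eqP; rewrite eqr_nat => /eqP.
by move=> /(_ isT); rewrite size_map size_iota ltnn.
Qed.

Unset Implicit Arguments.

Theorem theorem3 (R : realType) (n d : nat) (d_gt0 : (0 < d)%N)
    (d_le_n : (d <= n)%N) (P : set 'rV[R]_n) (latP : lattice_polytope P)
    (dimP : has_dim P d) (t : nat) (t_gt0 : (0 < t)%N) :
  Hcount_int P t = ehrhart (relint (pyramid P)) t.+1 /\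
  (ehrhart (relint (pyramid P)) t.+1)%:R
    = (-1) ^+ d.+1 * (Hpoly P).[- t%:R - 1] :> R.
Proof.
have [k [V [k_gt0 eqP]]] := lattice_polytope_hull latP.
rewrite {}eqP in dimP *.
have rankW := rank_homogenization dimP.
(* As [d > 0], the rank is at least 2, so [P] is not a point and a giganture determines its factor
   [i]. *)
have nonconst : exists j, exists i i',
    map_mx (@intmul R 1) V i j != map_mx (@intmul R 1) V i' j.
  by apply: (nonconst_rows k_gt0); rewrite rankW ltnS.
split; first by rewrite (Hcount_int_hull k_gt0) // ehrhart_relint_pyramid.
have [q [qE qrec]] := cone_reciprocity R (homogenization_height V).
suff -> : Hpoly (hull (map_mx (@intmul R 1) V)) = q.
  by rewrite ehrhart_relint_pyramid // qrec rankW.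
have qP t' : q.[t'%:R] = (Hcount (hull (map_mx (@intmul R 1) V)) t')%:R.
  by rewrite (Hcount_hull k_gt0 nonconst) qE.
(* The existence of [q] ensures that [Hpoly] is an interpolating polynomial and not merely the
   default value. *)
have HpolyP : [set p : {poly R} | forall t' : nat,
    p.[t'%:R] = (Hcount (hull (map_mx (@intmul R 1) V)) t')%:R]
    (Hpoly (hull (map_mx (@intmul R 1) V))) by apply: xgetPex; exists q.
by apply: poly_eq_nat => t'; rewrite qP HpolyP.
Qed.
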